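(* Let $r\ge 2$, let $n_1\leq n_2\leq\dots\leq n_r$ be positive integers, and set $n=n_1+\dots+n_r$. Let $s\geq 0$ be an integer. Consider in $\mathbb{P}^n$ a set of $s$ generic points $P_1,\ldots,P_s$ and $r$ generic linear spaces $\Lambda_1,\ldots,\Lambda_r$ of dimensions $n_1-1,\ldots,n_r-1$, respectively. Then the configuration of linear spaces \[\Lambda=\Lambda_1\cup\ldots\cup\Lambda_r\cup\{P_1,\ldots,P_s\}\subset\mathbb{P}^n\] is feasible if and only if one of the following holds: (a) $1<n_1<n_2$ and $s\leq n_1+3$; or (b) ($n_1=1$ or $n_1=n_2$) and $s\leq n_2+2$.
   Context: Work over $\mathbb{C}$. A rational normal curve in $\mathbb{P}^n$ is a curve projectively equivalent to the image of the degree $n$ Veronese embedding of $\mathbb{P}^1$ in $\mathbb{P}^n$. A configuration of linear spaces $\Lambda=\Lambda_1\cup\dots\cup\Lambda_t\subset\mathbb{P}^n$, a finite union of linear subspaces of dimension at most $n-2$ (points are linear spaces of dimension $0$), is called feasible if there exists a rational normal curve $\mathcal{C}\subset\mathbb{P}^n$ maximally intersecting it, i.e. such that the scheme $\mathcal{C}\cap\Lambda_i$ has degree $\dim\Lambda_i+1$ for every component $\Lambda_i$. ''Generic'' means that the tuple of linear components is chosen in a suitable non-empty Zariski open subset of the corresponding product of Grassmannians. *)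

(* Defs.v *)
From HB Require Import structures.
From mathcomp Require Import all_boot all_order all_algebra.
From mathcomp Require Import mpoly reals complex.

Set Implicit Arguments.
Unset Strict Implicit.
Unset Printing Implicit Defensive.

Import GRing.Theory.
Local Open Scope ring_scope.

(* P^n over an algebraically closed field K is the space of lines of          *)
(* 'rV[K]_n.+1.  A set of points of P^n is given by the nonzero vectors that  *)
(* represent its points.  A linear subspace of P^n of dimension d is a vector *)
(* subspace of dimension d.+1; in particular a point is a line.               *)

Section ProjectiveGeometry.
Variables (K : closedFieldType) (n : nat).

Definition linear_points (L : {vspace 'rV[K]_n.+1}) : 'rV[K]_n.+1 -> Prop :=
  fun v => v != 0 /\ v \in L.

Definition veronese (s t : K) : 'rV[K]_n.+1 :=
  \row_(i < n.+1) (s ^+ (n - i) * t ^+ i).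

Definition rational_normal_curve (C : 'rV[K]_n.+1 -> Prop) : Prop :=
  exists2 A : 'M[K]_n.+1, A \in unitmx &
    forall v, C v <->
      exists s t c : K,
        [/\ (s, t) != (0, 0), c != 0 & v = c *: (veronese s t *m A)].

(* The degree-k part of the homogeneous ideal of a set of points.             *)
Definition vanishing (X : 'rV[K]_n.+1 -> Prop) (k : nat)
    (p : dhomog n.+1 K k) : Prop :=
  forall v, X v -> (p : {mpoly K[n.+1]}).@[fun i => v 0 i] = 0.

(* Let X and Y be closed subvarieties of P^n, with homogeneous ideals I(X)    *)
(* and I(Y) in the coordinate ring S.  Their scheme-theoretic intersection is *)
(* defined by I(X) + I(Y); it is finite of degree d when its Hilbert          *)
(* polynomial is the constant d, i.e. when (I(X) + I(Y))_k has codimension d  *)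
(* in S_k for all large k.                                                    *)
Definition intersection_degree (X Y : 'rV[K]_n.+1 -> Prop) (d : nat) : Prop :=
  exists k0 : nat, forall k : nat, (k0 <= k)%N ->
    exists2 J : {vspace dhomog n.+1 K k},
      forall p, p \in J <->
        exists q1 q2, [/\ vanishing X q1, vanishing Y q2 & p = q1 + q2]
      & (\dim J + d)%N = \dim {: dhomog n.+1 K k}.

Definition feasible (I : finType) (L : I -> {vspace 'rV[K]_n.+1}) : Prop :=
  exists2 C, rational_normal_curve C &
    forall i, intersection_degree C (linear_points (L i)) (\dim (L i)).

Section Generic.
Variables (I : finType) (d : I -> nat).

Definition frames : Type := forall i, (d i).-tuple 'rV[K]_n.+1.

Definition frame_of (L : I -> {vspace 'rV[K]_n.+1}) (e : frames) : Prop :=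
  forall i, basis_of (L i) (e i).

Definition frame_coord : finType := {i : I & ('I_(d i) * 'I_n.+1)%type}.

Definition frame_eval (f : {mpoly K[#|frame_coord|]}) (e : frames) : K :=
  f.@[fun x => let u := enum_val x : frame_coord in
               tnth (e (tag u)) (tagged u).1 0 (tagged u).2].

(* Zariski topology on the product of the Grassmannians Gr(d i, n.+1): it is  *)
(* the quotient of the open set of tuples of frames in affine space by change *)
(* of frames, so U is open iff the set of frames of members of U is, i.e. iff *)
(* the latter is the locus where some polynomial of a family F is nonzero.    *)
Definition zariski_open (U : (I -> {vspace 'rV[K]_n.+1}) -> Prop) : Prop :=
  exists F : {mpoly K[#|frame_coord|]} -> Prop,
    forall L e, frame_of L e ->
      (U L <-> exists2 f, F f & frame_eval f e != 0).

Definition grassmannian_product (L : I -> {vspace 'rV[K]_n.+1}) : Prop :=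
  forall i, \dim (L i) = d i.

Definition for_generic (Q : (I -> {vspace 'rV[K]_n.+1}) -> Prop) : Prop :=
  exists U, [/\ zariski_open U,
    exists2 L, grassmannian_product L & U L &
    forall L, grassmannian_product L -> U L -> Q L].

End Generic.
End ProjectiveGeometry.

(* Vector space dimensions of the components: m i for the i-th linear space   *)
(* (of projective dimension m i - 1) and 1 for each of the s points.          *)
Definition component_dim (r s : nat) (m : nat -> nat) (x : 'I_r + 'I_s) : nat :=
  match x with inl i => m i | inr _ => 1 end.
Arguments component_dim : clear implicits.

(* Main.v *)
Require Import Defs.
From HB Require Import structures.
From mathcomp Require Import all_boot all_order all_algebra.
From mathcomp Require Import mpoly reals complex zify ring.

(* Choose a form h_i of degree n_i cutting the curve C in its divisor on      *)
(* Lambda_i.  The linear forms vanishing on Lambda_i restrict to C as the     *)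
(* multiples of h_i; conversely, a curve with this property meets Lambda_i in *)
(* a scheme of degree n_i.  Projecting C from all the Lambda_j with j <> i    *)
(* gives a rational normal curve C_i in P^{n_i}, so Lambda is feasible iff    *)
(* there are such curves C_i through the projections of the P_j, attained at  *)
(* parameters t_j that are the same for all i, with pairwise coprime h_i.     *)
(*                                                                            *)
(* At most n_i + 2 generic points impose no condition on the t_j.  For        *)
(* n_i + 3 points the t_j are determined up to PGL_2 (Gale duality), and when *)
(* n_i = 1 they are determined by C_i = P^1.  This gives the curves in the    *)
(* feasible cases; that the resulting parametrisation is nondegenerate is an  *)
(* open condition on the frames, checked on one configuration with simple     *)
(* h_i.                                                                       *)
(*                                                                            *)
(* In the other cases there are two ways of reading the cross ratio of the    *)
(* parameters of four of the points from determinants of n + 1 vectors (using *)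
(* the projections to two different P^{n_i}, or two different sets of         *)
(* auxiliary points in P^{n_1}), and the equality of the two values is a      *)
(* nontrivial polynomial condition on the configuration.                      *)

Set Implicit Arguments.
Unset Strict Implicit.
Unset Printing Implicit Defensive.

Import GRing.Theory.
Local Open Scope ring_scope.

(** * Restriction of forms to a parametrised curve *)

(** The geometry is reduced to polynomials in one variable. A curve is an invertible matrix [A];
    restricting forms of degree k to it yields exactly the polynomials of degree at most kn
    ([pull_surj]), and [annih A L] consists of the restrictions of linear forms vanishing on L.
    [intersection_degree_divisor] and [intersection_degree_of_divisor] translate the degree of the
    scheme C ∩ L into the statement that [annih A L] is made of the multiples of one divisor h.

    Infeasibility: take components of total vector dimension n - 1 and let G be the product of their
    divisors. The linear forms restricting to G and G X vanish on all of these components, so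
    projecting from their span to P^1 recovers the parameter of C. The cross ratio of the parameters
    of four further points is therefore read from determinants, whatever centre is used
    ([det_pair_feasible], [feasible_cross_ratio]), and two centres give an equation that fails
    generically ([cross_ratio_nonzero]). A centre omitting only the i-th block needs m i - 1
    auxiliary points. With m 1 + 3 points one compares the blocks 0 and 1; with m 0 + 4 points and m
    0 > 1, two sets of auxiliary points for block 0.

    Feasibility: curves in the P^(m i) with a common parameter are glued by [curve_coef]. Each is a
    Lagrange interpolant whose degree is lowered by linear relations between the points: one
    relation for m i + 2 points at arbitrary parameters ([standard_block]), two for m 0 + 3 points
    at the parameters forced by Gale duality ([feasible_gale]); a block with m 0 = 1 gives the
    parameters directly ([feasible_line_block]). All data are polynomial in the frames, so one
    nondegenerate configuration suffices ([generic_feasible]). *)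

Lemma size_polyM_leq (R : nzSemiRingType) (f g : {poly R}) a b :
  (size f <= a.+1)%N -> (size g <= b.+1)%N -> (size (f * g)%R <= (a + b).+1)%N.
Proof. by move=> fa gb; have := size_polyMleq f g; lia. Qed.

Lemma size_polyMn0_leq (R : idomainType) (h q : {poly R}) a b :
  h != 0 -> (size h + a <= b.+1)%N -> (size q <= a)%N -> (size (h * q)%R <= b)%N.
Proof.
move=> h0 ha qa; have [->|q0] := eqVneq q 0; first by rewrite mulr0 size_poly0.
by rewrite size_mul //; lia.
Qed.

Section InfiniteField.
Variable K : closedFieldType.

Lemma closed_field_fresh (s : seq K) : exists x, x \notin s.
Proof.
pose p := \prod_(a <- s) ('X - a%:P) + 1 : {poly K}.
have [->|s0] := eqVneq s [::]; first by exists 0.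
have szp : size p = (size s).+1.
  by rewrite size_polyDl size_prod_XsubC // size_poly1 ltnS lt0n size_eq0.
have /closed_rootP [x] : size p != 1 by rewrite szp eqSS size_eq0.
rewrite rootE hornerD hornerC => /eqP px; exists x; apply/negP => xs.
move: px; rewrite (_ : _.[x] = 0) ?add0r; last first.
  by apply/eqP; rewrite -rootE root_prod_XsubC.
by apply/eqP; exact: oner_neq0.
Qed.

Lemma closed_field_fresh_uniq (bad : seq K) N :
  exists s, [/\ uniq s, size s = N & forall x, x \in s -> x \notin bad].
Proof.
elim: N => [|N [s [us ss sb]]]; first by exists [::].
have [x] := closed_field_fresh (bad ++ s); rewrite mem_cat negb_or => /andP[xb xs].
exists (x :: s); split; rewrite /= ?us ?xs ?ss // => y.
by rewrite inE => /orP[/eqP->|/sb].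
Qed.

Lemma poly_fun_eq0 (p : {poly K}) : (forall x, p.[x] = 0) -> p = 0.
Proof.
move=> p0; have [s [us ss _]] := closed_field_fresh_uniq [::] (size p).
apply: (@roots_geq_poly_eq0 _ p s) => //; last by rewrite ss.
by apply/allP => x _; rewrite rootE p0.
Qed.

Lemma poly_fun_eq0_except (p : {poly K}) (bad : seq K) :
  (forall x, x \notin bad -> p.[x] = 0) -> p = 0.
Proof.
move=> p0; have [s [us ss sb]] := closed_field_fresh_uniq bad (size p).
apply: (@roots_geq_poly_eq0 _ p s) => //; last by rewrite ss.
by apply/allP => x /sb /p0 px; rewrite rootE px.
Qed.

End InfiniteField.

Section Pullback.
Variables (K : closedFieldType) (n : nat).
Implicit Types (A : 'M[K]_n.+1) (p q : {mpoly K[n.+1]}) (c : 'cV[K]_n.+1).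

Definition curve_coord A (i : 'I_n.+1) : {poly K} := rVpoly (col i A)^T.

Lemma size_curve_coord A i : (size (curve_coord A i) <= n.+1)%N.
Proof. exact: size_poly. Qed.

Lemma horner_rVpoly d (v : 'rV[K]_d) x :
  (rVpoly v).[x] = \sum_(i < d) v 0 i * x ^+ i.
Proof.
rewrite horner_poly; apply: eq_bigr => i _; rewrite insubT //= => lti.
by congr (v _ _ * _); apply: val_inj.
Qed.

Lemma curve_coordE A i x : (curve_coord A i).[x] = (veronese n 1 x *m A) 0 i.
Proof.
rewrite horner_rVpoly mxE; apply: eq_bigr => j _.
by rewrite !mxE expr1n mul1r mulrC.
Qed.

(** Restriction to the curve in the chart where the first parameter is 1; a zero at infinity shows
    only as a drop below degree kn. *)
Definition pull A : {mpoly K[n.+1]} -> {poly K} := mmap polyC (curve_coord A).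

HB.instance Definition _ A := GRing.RMorphism.on (pull A).

Lemma pullE A p x : (pull A p).[x] = p.@[fun i => (veronese n 1 x *m A) 0 i].
Proof.
rewrite /pull /mmap mevalE horner_sum; apply: eq_bigr => m _.
rewrite hornerM hornerC /mmap1 horner_prod; congr (_ * _).
by apply: eq_bigr => i _; rewrite horner_exp curve_coordE.
Qed.

Lemma pullZ A a p : pull A (a *: p) = a *: pull A p.
Proof. by rewrite /pull mmapZ mul_polyC. Qed.

Lemma veroneseZ s t a : veronese n (a * s) (a * t) = a ^+ n *: veronese n s t :> 'rV[K]_n.+1.
Proof.
apply/rowP => i; rewrite !mxE !exprMn mulrACA -exprD subnK //.
by rewrite -ltnS.
Qed.

Lemma homog_mevalZ k p (v : 'I_n.+1 -> K) a : p \is k.-homog ->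
  p.@[fun i => a * v i] = a ^+ k * p.@[v].
Proof.
move=> /dhomogP hp; rewrite !mevalE mulr_sumr big_seq [RHS]big_seq.
apply: eq_bigr => m /hp /= <-; rewrite mulrCA; congr (_ * _).
under eq_bigr do rewrite exprMn.
by rewrite big_split /= prodrXr mdegE.
Qed.

Lemma size_pull A k p : p \is k.-homog -> (size (pull A p) <= (k * n).+1)%N.
Proof.
move=> /dhomogP hp; rewrite /pull /mmap big_seq.
elim/big_ind: _ => [|f g fs gs|m /hp /= <-]; first by rewrite size_poly0.
  by rewrite (leq_trans (size_polyD _ _)) // geq_max fs.
rewrite mul_polyC (leq_trans (size_scale_leq _ _)) // /mmap1 mdegE big_distrl /=.
apply: (big_ind2 (fun (f : {poly K}) d => (size f <= d.+1)%N)) => [|f d g e fs gs|i _]; first by rewrite size_poly1.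
  exact: size_polyM_leq.
apply: leq_trans (size_poly_exp_leq _ _) _; rewrite ltnS mulnC leq_mul2l.
by apply/orP; right; have := size_curve_coord A i; case: (size _).
Qed.

Definition linform c : {mpoly K[n.+1]} := \sum_i c i 0 *: 'X_i.

Lemma linform_homog c : linform c \is 1.-homog.
Proof.
by apply: rpred_sum => i _; apply: rpredZ; rewrite dhomogX; exact/eqP/mdeg1.
Qed.

Lemma linformE c (v : 'rV[K]_n.+1) : (linform c).@[fun i => v 0 i] = (v *m c) 0 0.
Proof.
rewrite raddf_sum mxE; apply: eq_bigr => i _.
by rewrite /= mevalZ mevalXU mulrC.
Qed.

Lemma pull_linform A c : pull A (linform c) = rVpoly (A *m c)^T.
Proof.
apply/eqP; rewrite -subr_eq0; apply/eqP/poly_fun_eq0 => x.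
rewrite hornerD hornerN pullE linformE -mulmxA horner_rVpoly mxE.
apply/eqP; rewrite subr_eq0; apply/eqP/eq_bigr => i _.
by rewrite !mxE expr1n mul1r mulrC.
Qed.

(* The linear form that restricts to [g] on the curve. *)
Definition lift_poly A (g : {poly K}) : 'cV[K]_n.+1 := invmx A *m (poly_rV g)^T.

Lemma pull_lift A (g : {poly K}) : A \in unitmx -> (size g <= n.+1)%N ->
  pull A (linform (lift_poly A g)) = g.
Proof.
move=> uA sg; rewrite pull_linform /lift_poly mulKVmx // trmxK.
exact: poly_rV_K.
Qed.

(** Projective normality of the rational normal curve: write f as a low part plus ['X^n] times a
    high part, where ['X^n] and the low part are restrictions of linear forms, and induct on k. *)
Lemma pull_surj A k (f : {poly K}) : A \in unitmx ->
  (size f <= (k * n).+1)%N -> exists2 q, q \is k.-homog & pull A q = f.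
Proof.
move=> uA; elim: k f => [|k IH] f sf.
  rewrite mul0n in sf; exists (f`_0)%:MP; last by rewrite /pull mmapC [RHS]size1_polyC.
  by rewrite -[_%:MP]mulr1 mul_mpolyC rpredZ ?dhomog1.
have [q1 h1 p1] : exists2 q, q \is k.-homog & pull A q = drop_poly n f.
  by apply: IH; rewrite size_drop_poly leq_subLR addnS -mulSn.
have [q2 h2 p2] : exists2 q, q \is k.-homog & pull A q = 1.
  by apply: IH; rewrite size_poly1.
exists (linform (lift_poly A 'X^n) * q1 + linform (lift_poly A (take_poly n f)) * q2).
  by apply: rpredD; rewrite -[k.+1]add1n; apply: dhomogM => //; exact: linform_homog.
rewrite rmorphD !rmorphM /= p1 p2 mulr1 !pull_lift ?size_polyXn //; last first.
  by rewrite (leq_trans (size_take_poly _ _)).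
by rewrite mulrC addrC poly_take_drop.
Qed.

End Pullback.

Section Traces.
Variables (K : closedFieldType) (n : nat) (A : 'M[K]_n.+1).
Variable L : {vspace 'rV[K]_n.+1}.
Hypothesis uA : A \in unitmx.
Implicit Types f g h a : {poly K}.

(* [f] is the restriction to the curve of a form of degree [k] in the ideal   *)
(* of [L].                                                                    *)
Definition trace k f := exists q : {mpoly K[n.+1]},
  [/\ q \is k.-homog, forall v, linear_points L v -> q.@[fun i => v 0 i] = 0
    & pull A q = f].

Definition annih g :=
  (size g <= n.+1)%N /\ forall v, v \in L -> v *m lift_poly A g = 0.

Lemma trace0 k : trace k 0.
Proof. by exists 0; split=> [|v _|]; rewrite ?rpred0 ?raddf0. Qed.

Lemma traceD k f g : trace k f -> trace k g -> trace k (f + g).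
Proof.
move=> [p [hp vp <-]] [q [hq vq <-]]; exists (p + q).
split; rewrite ?rpredD ?raddfD // => v Lv.
by rewrite /= mevalD vp ?vq ?addr0.
Qed.

Lemma traceM k j f a :
  (size a <= (j * n).+1)%N -> trace k f -> trace (k + j) (f * a).
Proof.
move=> sa [p [hp vp <-]]; have [q hq <-] := pull_surj uA sa.
exists (p * q); split; rewrite ?rmorphM ?dhomogM // => v Lv.
by rewrite /= mevalM vp ?mul0r.
Qed.

Lemma trace_annih g : annih g -> trace 1 g.
Proof.
move=> [sg Lg]; exists (linform (lift_poly A g)); split.
- exact: linform_homog.
- by move=> v [_ Lv]; rewrite linformE Lg // mxE.
- exact: pull_lift.
Qed.

Lemma trace_annihM k g a :
  annih g -> (size a <= (k * n).+1)%N -> trace k.+1 (g * a).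
Proof. by move=> /trace_annih Tg sa; rewrite -[k.+1]add1n; exact: traceM. Qed.

Definition basis_mx : 'M[K]_(\dim L, n.+1) := \matrix_(i < \dim L) (vbasis L)`_i.

Lemma mul_basis_mx u : u *m basis_mx = \sum_i u 0 i *: (vbasis L)`_i.
Proof. by rewrite mulmx_sum_row; apply: eq_bigr => i _; rewrite rowK. Qed.

Lemma basis_mx_free : row_free basis_mx.
Proof.
apply: inj_row_free => u; rewrite mul_basis_mx => u0.
have := basis_free (vbasisP L) => /freeP /(_ _ u0) h.
by apply/rowP => i; rewrite h mxE.
Qed.

Lemma basis_mxP v : reflect (exists u, v = u *m basis_mx) (v \in L).
Proof.
apply: (iffP idP) => [Lv|[u ->]].
  exists (\row_i coord (vbasis L) i v); rewrite mul_basis_mx.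
  by rewrite {1}(coord_vbasis Lv); apply: eq_bigr => i _; rewrite mxE.
rewrite mul_basis_mx; apply: rpred_sum => i _; apply: rpredZ.
by apply: vbasis_mem; rewrite mem_nth // size_tuple.
Qed.

Definition annih_mx : 'M[K]_(n.+1, \dim L) := (basis_mx *m invmx A)^T.

Lemma annih_mxP g :
  annih g <-> (size g <= n.+1)%N /\ (poly_rV g <= kermx annih_mx)%MS.
Proof.
rewrite /annih; split=> -[sg Lg]; split=> //.
  apply/sub_kermxP; apply: trmx_inj; rewrite trmx_mul trmxK trmx0 -mulmxA.
  apply/row_matrixP => i; rewrite row_mul row0 Lg //.
  by rewrite rowK vbasis_mem // mem_nth // size_tuple.
move=> v /basis_mxP[u ->]; rewrite /lift_poly !mulmxA -(mulmxA u).
move/sub_kermxP: Lg => /(congr1 trmx); rewrite trmx_mul trmxK trmx0 => Lg.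
by rewrite -mulmxA Lg mulmx0.
Qed.

Lemma rank_annih_mx : \rank (kermx annih_mx) = (n.+1 - \dim L)%N.
Proof.
rewrite mxrank_ker mxrank_tr mxrankMfree ?row_free_unit ?unitmx_inv //.
by move: basis_mx_free => /eqP ->.
Qed.

Definition mulp_row T N h (u : 'rV[K]_T) : 'rV[K]_N := poly_rV (h * rVpoly u).

Lemma mulp_row_is_linear T N h : linear (@mulp_row T N h).
Proof.
by move=> c u v; rewrite /mulp_row linearP mulrDr -scalerAr linearP.
Qed.
HB.instance Definition _ T N h :=
  GRing.isLinear.Build K _ _ _ (@mulp_row T N h) (@mulp_row_is_linear T N h).

Lemma size_mulp T N h (u : 'rV[K]_T) : h != 0 -> (size h + T <= N.+1)%N ->
  (size (h * rVpoly u)%R <= N)%N.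
Proof.
by move=> h0 hT; apply: size_polyMn0_leq h0 hT _; exact: size_poly.
Qed.

Lemma mulp_row_inj T N h : h != 0 -> (size h + T <= N.+1)%N ->
  injective (@mulp_row T N h).
Proof.
move=> h0 hT u v /(congr1 rVpoly); rewrite !poly_rV_K ?size_mulp //.
by move/(mulfI h0)/(can_inj rVpolyK).
Qed.

(** A dimension count: the restrictions of linear forms vanishing on L form a space of dimension n +
    1 - dim L, contained in the M-dimensional space of multiples of h, so the two coincide. *)
Lemma annih_multiples h M : h != 0 -> (size h + M <= n.+2)%N ->
    (M + \dim L <= n.+1)%N ->
    (forall g, annih g -> exists2 q : {poly K}, (size q <= M)%N & g = h * q) ->
  (M + \dim L = n.+1)%N /\ forall q : {poly K}, (size q <= M)%N -> annih (h * q).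
Proof.
move=> h0 hM Ld hG; pose Mh := lin1_mx (@mulp_row M n.+1 h).
have sub : (kermx annih_mx <= Mh)%MS.
  apply/row_subP => i; set r := row i _.
  have [|q sq rq] := hG (rVpoly r).
    by apply/annih_mxP; rewrite rVpolyK row_sub size_poly.
  apply/submxP; exists (poly_rV q).
  by rewrite mul_rV_lin1 /= /mulp_row poly_rV_K // -rq rVpolyK.
have rk := mxrankS sub; have rkM := rank_leq_row Mh.
rewrite rank_annih_mx in rk.
have eqM : (M + \dim L = n.+1)%N by have := leq_trans rk rkM; move: Ld; clear; lia.
split=> // q sq; apply/annih_mxP; split.
  exact: size_polyMn0_leq h0 hM sq.
have -> : poly_rV (h * q) = poly_rV q *m Mh.
  by rewrite mul_rV_lin1 /= /mulp_row poly_rV_K.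
apply: submx_trans (submxMl _ _) _.
rewrite -(mxrank_leqif_sup sub).2 rank_annih_mx eqn_leq rk /=; lia.
Qed.

End Traces.

Section RestrictionMaps.
Variables (K : closedFieldType) (n : nat) (A : 'M[K]_n.+1).
Hypothesis uA : A \in unitmx.

Definition pull_row k (q : dhomog n.+1 K k) : 'rV[K]_(k * n).+1 :=
  poly_rV (pull A q).

Lemma pull_row_is_linear k : linear (@pull_row k).
Proof.
by move=> c p q; rewrite /pull_row linearP /= raddfD /= pullZ linearP.
Qed.
HB.instance Definition _ k :=
  GRing.isLinear.Build K _ _ _ (@pull_row k) (@pull_row_is_linear k).

Definition pull_mod k d (h : {poly K}) (q : dhomog n.+1 K k) : 'rV[K]_d :=
  poly_rV (pull A q %% h).

Lemma pull_mod_is_linear k d h : linear (@pull_mod k d h).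
Proof.
move=> c p q; rewrite /pull_mod linearP /= raddfD /= pullZ.
by rewrite modpD modpZl linearP.
Qed.
HB.instance Definition _ k d h :=
  GRing.isLinear.Build K _ _ _ (@pull_mod k d h) (@pull_mod_is_linear k d h).

Lemma pull_row_surj k : limg (linfun (@pull_row k)) = fullv.
Proof.
apply/vspaceP => v; rewrite memvf.
have [|q hq pq] := @pull_surj _ _ A k (rVpoly v) uA; first exact: size_poly.
apply/memv_imgP; exists (DHomog hq); rewrite ?memvf // lfunE /= /pull_row /=.
by rewrite pq rVpolyK.
Qed.

Lemma lker_pull_row k (q : dhomog n.+1 K k) :
  (q \in lker (linfun (@pull_row k))) = (pull A q == 0).
Proof.
rewrite memv_ker lfunE /= /pull_row; apply/eqP/eqP => [|->]; last by rewrite linear0.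
have sq := size_pull A (valP q).
by move=> /(congr1 rVpoly); rewrite poly_rV_K // linear0.
Qed.

(** A space of forms containing the kernel of restriction has the same codimension as its image
    among polynomials of degree at most kn. *)
Lemma dim_pull_row k (J : {vspace dhomog n.+1 K k}) :
    (lker (linfun (@pull_row k)) <= J)%VS ->
  (\dim (linfun (@pull_row k) @: J) + \dim {: dhomog n.+1 K k}
     = \dim J + (k * n).+1)%N.
Proof.
move=> kJ; have := limg_ker_dim (linfun (@pull_row k)) J.
have := limg_ker_dim (linfun (@pull_row k)) {: dhomog n.+1 K k}.
rewrite pull_row_surj.
have -> : \dim {: 'rV[K]_(k * n).+1} = (k * n).+1 by rewrite dimvf /dim /= mul1n.
by rewrite (capv_idPr kJ) capfv => <- <-; rewrite addnA [in LHS](addnC (\dim (_ @: J))).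
Qed.

End RestrictionMaps.

(** * Intersection degrees and divisors *)

Lemma leq_pred_addr a b c : (0 < c)%N -> ((a + c).-1 <= (b + c).-1)%N -> (a <= b)%N.
Proof. lia. Qed.

Lemma ideal_common_divisor (F : fieldType) (I : {poly F} -> Prop) :
    I 0 -> (forall f g, I f -> I g -> I (f + g)) ->
    (forall f a, I f -> I (f * a)) ->
  forall gs : seq {poly F}, (forall g, g \in gs -> I g) ->
  exists2 h, I h & forall g, g \in gs -> h %| g.
Proof.
move=> I0 ID IM; elim=> [|g gs IH] Igs; first by exists 0.
have [|h Ih hgs] := IH; first by move=> f fs; apply: Igs; rewrite inE fs orbT.
have [[u v] /= /eqp_dvdl uv] := Bezoutp g h.
exists (u * g + v * h) => [|f].
  by apply: ID; rewrite mulrC; apply: IM => //; apply: Igs; rewrite inE eqxx.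
rewrite uv inE => /orP[/eqP->|fs]; first exact: dvdp_gcdl.
exact: dvdp_trans (dvdp_gcdr _ _) (hgs _ fs).
Qed.

Lemma dvdp_mmap_sub (F : fieldType) n (h : {poly F}) (u w : 'I_n -> {poly F})
    (q : {mpoly F[n]}) :
  (forall i, h %| u i - w i) -> h %| mmap polyC u q - mmap polyC w q.
Proof.
pose R f g := h %| f - g.
have RD f g f' g' : R f g -> R f' g' -> R (f + f') (g + g').
  by rewrite /R opprD addrACA; exact: dvdp_add.
have RM f g f' g' : R f g -> R f' g' -> R (f * f') (g * g').
  move=> fg fg'; rewrite /R (_ : _ - _ = (f - g) * f' + g * (f' - g')).
    by apply: dvdp_add; [exact: dvdp_mulr | exact: dvdp_mull].
  by rewrite mulrBl mulrBr subrKA.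
have R1 f : R f f by rewrite /R subrr dvdp0.
move=> huw; apply: (big_ind2 R (R1 0) RD) => m _; apply: (RM) => //.
rewrite /mmap1; apply: (big_ind2 R (R1 1) RM) => i _.
by elim: (m i) => [|k IH]; rewrite ?expr0 ?exprS //; apply: (RM) => //; exact: huw.
Qed.

Section IntersectionDegree.
Variables (K : closedFieldType) (n : nat) (A : 'M[K]_n.+1).
Hypothesis uA : A \in unitmx.
Variable C : 'rV[K]_n.+1 -> Prop.
Hypothesis CE : forall v, C v <->
  exists s t c : K, [/\ (s, t) != (0, 0), c != 0 & v = c *: (veronese n s t *m A)].

Lemma vanishing_curve k (q : dhomog n.+1 K k) : vanishing C q <-> pull A q = 0.
Proof.
split=> [Cq|q0 v /CE [s [t [c [st c0 ->]]]]].
  apply: poly_fun_eq0 => x; rewrite pullE; apply: Cq; apply/CE.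
  exists 1, x, 1; split; rewrite ?oner_neq0 ?scale1r //.
  by rewrite xpair_eqE oner_eq0.
have vE w : w.@[fun i => (c *: (veronese n s t *m A)) 0 i]
    = w.@[fun i => c * (veronese n s t *m A) 0 i].
  by apply: meval_eq => i; rewrite !mxE.
rewrite vE (homog_mevalZ _ _ (valP q)).
have nz s' : s' != 0 -> (val q).@[fun i => (veronese n s' t *m A) 0 i] = 0.
  move=> s0; have -> : veronese n s' t = s' ^+ n *: veronese n 1 (t / s') :> 'rV[K]_n.+1.
    by rewrite -veroneseZ mulr1 mulrC divfK.
  rewrite -scalemxAl (meval_eq (v2 := fun i => s' ^+ n * (veronese n 1 (t / s') *m A) 0 i)).
    by rewrite (homog_mevalZ _ _ (valP q)) -pullE q0 horner0 mulr0.
  by move=> i; rewrite !mxE.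
(* The point at infinity: for fixed [t] the value of q is a polynomial [F] in the first parameter,
   zero at every nonzero argument and hence at 0. *)
pose u i : {poly K} := \sum_(j < n.+1) (t ^+ j * A j i) *: 'X^(n - j).
pose F := mmap polyC u (val q).
have FE x : F.[x] = (val q).@[fun i => (veronese n x t *m A) 0 i].
  rewrite /F /mmap mevalE horner_sum; apply: eq_bigr => m _.
  rewrite hornerM hornerC /mmap1 horner_prod; congr (_ * _).
  apply: eq_bigr => i _; rewrite horner_exp; congr (_ ^+ _).
  rewrite /u horner_sum mxE; apply: eq_bigr => j _.
  by rewrite hornerZ hornerXn !mxE mulrC mulrA.
have F0 : F = 0.
  apply: (@poly_fun_eq0_except _ _ [:: 0]) => x; rewrite inE => x0.
  by rewrite FE nz.
by rewrite -FE F0 horner0 mulr0.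
Qed.

Section Forward.
Variable L : {vspace 'rV[K]_n.+1}.
Hypotheses (n_gt0 : (0 < n)%N) (Ln : (\dim L <= n)%N).

(** A common divisor h of the linear traces can be chosen to be a trace in all large degrees.
    Comparing dimensions there bounds the number of multiples of h, and [annih_multiples] turns the
    bound into an equality. The size of h is only bounded because the curve may meet L at
    infinity. *)
Lemma intersection_degree_divisor :
    intersection_degree C (linear_points L) (\dim L) ->
  exists h : {poly K}, [/\ h != 0, (size h <= (\dim L).+1)%N &
    forall q : {poly K}, (size q <= n.+1 - \dim L)%N -> annih A L (h * q)].
Proof.
case=> k0 HJ; set ker := kermx (annih_mx A L).
pose gs (i : 'I_n.+1) := rVpoly (row i ker).
have gsP i : annih A L (gs i).
  by apply/annih_mxP; rewrite rVpolyK row_sub size_poly.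
have gsE g : annih A L g -> exists a : 'I_n.+1 -> K, g = \sum_i a i *: gs i.
  move=> /annih_mxP[sg /submxP[u ug]]; exists (fun i => u 0 i).
  rewrite -[LHS](poly_rV_K sg) ug mulmx_sum_row raddf_sum.
  by apply: eq_bigr => i _; rewrite /= linearZ.
(* Traces in all large degrees form an ideal of the polynomial ring: as n > 0, raising the degree
   makes room for any multiplier. *)
pose I f := exists N, forall k, (N <= k)%N -> trace A L k f.
have I0 : I 0 by exists 0 => k _; exact: trace0.
have ID f g : I f -> I g -> I (f + g).
  move=> [N1 h1] [N2 h2]; exists (maxn N1 N2) => k; rewrite geq_max => /andP[l1 l2].
  by apply: traceD; [exact: h1 | exact: h2].
have IM f a : I f -> I (f * a).
  move=> [N hN]; exists (N + size a)%N => k Nk.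
  rewrite -(subnK (_ : size a <= k)%N); last exact: leq_trans (leq_addl _ _) Nk.
  apply: (traceM uA) => //; first by rewrite (leq_trans (leq_pmulr _ n_gt0)).
  by apply: hN; rewrite -(leq_add2r (size a)) subnK // (leq_trans (leq_addl _ _) Nk).
have Igs i : I (gs i).
  exists 1%N => -[|k] // _; rewrite -[gs i]mulr1; apply: (trace_annihM uA) => //.
  by rewrite size_poly1.
have [|h [N hN] hgs] := ideal_common_divisor I0 ID IM (gs := codom gs).
  by move=> g /codomP[i ->].
have {}hgs i : h %| gs i by apply: hgs; exact: codom_f.
pose i0 := [arg max_(i > ord0) size (gs i)].
have i0P i : (size (gs i) <= size (gs i0))%N.
  by rewrite /i0; case: arg_maxnP => // j _; apply.
have gmax g : annih A L g -> (size g <= size (gs i0))%N.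
  case/gsE => a ->; apply: leq_trans (size_sum _ _ _) _.
  by apply/bigmax_leqP => i _; rewrite (leq_trans (size_scale_leq _ _)).
have hg g : annih A L g -> h %| g.
  case/gsE => a ->; elim/big_ind: _ => [|f f'|i _]; rewrite ?dvdp0 //.
    exact: dvdp_add.
  by rewrite -mul_polyC dvdp_mull.
have g0 : gs i0 != 0.
  apply/eqP => gs0; have ker0 : ker = 0.
    apply/row_matrixP => i; rewrite row0 -[LHS]rVpolyK -/(gs i).
    suff -> : gs i = 0 by rewrite linear0.
    by apply/eqP; rewrite -size_poly_leq0 -(size_poly0 K) -gs0.
  have := rank_annih_mx L uA; rewrite -/ker ker0 mxrank0; lia.
have h0 : h != 0 by apply: contraNneq g0 => h0; have := hgs i0; rewrite h0 dvd0p.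
have /dvdpP[qs qsE] := hgs i0.
have qs0 : qs != 0 by apply: contraNneq g0 => q0; rewrite qsE q0 mul0r.
pose M := size qs.
have szM : (size (gs i0) = (M + size h).-1)%N by rewrite qsE size_mul.
have hM : (size h + M <= n.+2)%N.
  have [sg _] := gsP i0; rewrite szM in sg.
  by rewrite addnC (leq_trans (leqSpred _)).
(* Divide q by [qs]: the quotient multiplies the linear trace [gs i0], and the small remainder
   multiplies h, a trace in degree k. *)
have TkM k (q : {poly K}) : (N <= k)%N -> (size q <= k * n + M)%N -> trace A L k.+1 (h * q).
  move=> Nk sq; rewrite (divp_eq q qs) mulrDr; apply: traceD.
    rewrite mulrCA [h * qs]mulrC -qsE mulrC; apply: (trace_annihM uA) => //.
    rewrite size_divp // leq_subLR; apply: leq_trans sq _.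
    have M0 : (0 < M)%N by rewrite size_poly_gt0.
    by rewrite -/M addnS -addSn prednK // addnC.
  rewrite -addn1; apply: (traceM uA) => //; last exact: hN.
  rewrite mul1n ltnW // (leq_trans (ltn_modpN0 _ _)) //.
  have := gsP i0; rewrite /annih szM => -[+ _].
  have : (0 < size h)%N by rewrite size_poly_gt0.
  rewrite -/M; lia.
(* In degree k + 1 the sum of the two ideals restricts to a space of dimension (k + 1)n + 1 - dim L,
   which contains the multiples of h by polynomials of size at most kn + M. *)
have Md : (M + \dim L <= n.+1)%N.
  pose k := (N + k0)%N; pose T := (k * n + M)%N.
  have [|J JP dJ] := HJ k.+1; first exact: leq_trans (leq_addl N k0) (leqnSn _).
  have kerJ : (lker (linfun (pull_row A (k:=k.+1))) <= J)%VS.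
    apply/subvP => p; rewrite lker_pull_row => /eqP p0.
    apply/JP; exists p, 0; split; rewrite ?addr0 //; first exact/vanishing_curve.
    by move=> v _; rewrite /= raddf0.
  have hT : (size h + T <= ((k.+1 * n).+1).+1)%N.
    rewrite /T mulSn; move: hM; lia.
  have := dim_pull_row uA kerJ; rewrite -dJ.
  have : (T <= \dim (linfun (pull_row A (k:=k.+1)) @: J))%N.
    pose phi := linfun (@mulp_row K T (k.+1 * n).+1 h).
    have phi0 : lker phi == 0%VS.
      apply/lker0P => u v; rewrite !lfunE /=; exact: (mulp_row_inj h0 hT).
    have -> : T = \dim (phi @: fullv) by rewrite limg_dim_eq ?(eqP phi0) ?capv0 // dimvf /dim /= mul1n.
    apply: dimvS; apply/subvP => _ /memv_imgP[u _ ->].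
    have [||q [hq Lq pq]] := TkM k (rVpoly u); [by rewrite /k leq_addr|exact: size_poly|].
    apply/memv_imgP; exists (DHomog hq); last first.
      by rewrite !lfunE /= /mulp_row /pull_row /= pq.
    apply/JP; exists 0, (DHomog hq); split; rewrite ?add0r //.
    by move=> v _; rewrite /= raddf0.
  move: (\dim _) (\dim J) => x y; rewrite /T mulSn; lia.
have [|MdE Mall] := annih_multiples uA h0 hM Md.
  move=> g Lg; have /dvdpP[q gE] := hg g Lg; exists q; last by rewrite mulrC.
  have [->|q0] := eqVneq q 0; first by rewrite size_poly0.
  have := gmax g Lg; rewrite szM gE size_mul //.
  by apply: leq_pred_addr; rewrite size_poly_gt0.
exists h; split=> //; first by rewrite -(leq_add2r M) (leq_trans hM) // addSn addnC MdE.
by move=> q sq; apply: Mall; rewrite (leq_trans sq) // leq_subLR addnC MdE.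
Qed.

End Forward.

Section Backward.
Variables (L : {vspace 'rV[K]_n.+1}) (h : {poly K}).
Hypotheses (n_gt0 : (0 < n)%N) (Ln : (\dim L <= n)%N).
Hypothesis sz_h : size h = (\dim L).+1.
Hypothesis h_dvd : forall g, annih A L g -> h %| g.

Let h0 : h != 0. Proof. by rewrite -size_poly_gt0 sz_h. Qed.

(* With [pi] a projection onto [L], the coordinates of [v - pi v] are linear  *)
(* forms vanishing on [L], so that [q (v)] and [q (pi v) = 0] agree modulo [h] *)
(* along the curve.                                                           *)
Lemma dvdp_pull k (q : {mpoly K[n.+1]}) : q \is k.+1.-homog ->
  (forall v, linear_points L v -> q.@[fun i => v 0 i] = 0) -> h %| pull A q.
Proof.
move=> hq Lq; pose P := lin1_mx (projv L).
have PL v : v *m P \in L by rewrite mul_rV_lin1 memv_proj.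
have Pid v : v \in L -> v *m P = v by move=> Lv; rewrite mul_rV_lin1 /= projv_id.
have : h %| pull A q - pull (A *m P) q.
  apply: dvdp_mmap_sub => i; apply: h_dvd; split.
    by rewrite (leq_trans (size_polyD _ _)) // geq_max size_polyN !size_curve_coord.
  move=> v Lv; rewrite /lift_poly /curve_coord -linearB /= rVpolyK -linearB /= trmxK.
  rewrite !colE -!mulmxA -mulmxBr mulKmx // mulmxBr mulmxA Pid //.
  exact: subrr.
suff -> : pull (A *m P) q = 0 by rewrite subr0.
apply: poly_fun_eq0 => x; rewrite pullE mulmxA.
set v := _ *m P; have [v0|v0] := eqVneq v 0; last by apply: Lq; split; rewrite ?PL.
rewrite (meval_eq (v2 := fun i => 0 * v 0 i)); first by rewrite (homog_mevalZ _ _ hq) expr0n mul0r.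
by move=> i; rewrite mul0r v0 mxE.
Qed.

(** From degree 1 on, the sum of the two ideals is the kernel of restriction followed by reduction
    modulo h, and this map is onto the polynomials of degree less than dim L. *)
Lemma intersection_degree_of_divisor :
  intersection_degree C (linear_points L) (\dim L).
Proof.
exists 1%N => -[//|k] _; pose psi := linfun (@pull_mod K n A k.+1 (\dim L) h).
have hM : (size h + (n.+1 - \dim L) <= n.+2)%N by rewrite sz_h; lia.
have Md : (n.+1 - \dim L + \dim L <= n.+1)%N by lia.
have [|_ Gall] := annih_multiples uA h0 hM Md.
  move=> g Lg; have /dvdpP[q gE] := h_dvd Lg; exists q; last by rewrite mulrC.
  have [->|q0] := eqVneq q 0; first by rewrite size_poly0.
  have [+ _] := Lg; rewrite gE size_mul // sz_h addnS /= => sq.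
  by rewrite leq_subRL ?(leq_trans Ln) // addnC.
have psiE p : (p \in lker psi) = (h %| pull A p).
  rewrite memv_ker lfunE /= /pull_mod /dvdp; apply/eqP/eqP => [|->]; last by rewrite linear0.
  move=> /(congr1 rVpoly); rewrite poly_rV_K ?linear0 //.
  by rewrite -ltnS -sz_h ltn_modpN0.
exists (lker psi) => [p|].
  rewrite psiE; split=> [/dvdpP[q pq]|[q1 [q2 [/vanishing_curve q10 Lq2 ->]]]]; last first.
    by rewrite rmorphD /= q10 add0r; apply: dvdp_pull (valP q2) Lq2.
  have sq : (size q + \dim L <= (k.+1 * n).+1)%N.
    have [->|q0] := eqVneq q 0; first by rewrite size_poly0 mulSn; lia.
    by have := size_pull A (valP p); rewrite /= pq size_mul // sz_h addnS.
  (* Cut q at degree n - dim L: h times the low part is a linear trace, and so is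
     [h * 'X^(n - \dim L)], which the high part multiplies. *)
  have [q2 [hq2 Lq2 pq2]] : trace A L k.+1 (pull A p).
    rewrite pq mulrC -(poly_take_drop (n - \dim L) q) mulrDr; apply: traceD.
      rewrite -[h * _]mulr1; apply: (trace_annihM uA); rewrite ?size_poly1 //.
      by apply: Gall; rewrite (leq_trans (size_take_poly _ _)) // leq_sub2r.
    rewrite [_ * 'X^_]mulrC mulrA; apply: (trace_annihM uA) => //.
      by apply: Gall; rewrite size_polyXn; lia.
    by rewrite size_drop_poly leq_subLR; apply: leq_trans (_ : _ <= (k.+1 * n).+1 - \dim L)%N _;
      [rewrite leq_subRL 1?addnC // (leq_trans Ln) //|]; rewrite mulSn; lia.
  exists (p - DHomog hq2), (DHomog hq2); split=> //; last by rewrite subrK.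
  by apply/vanishing_curve; rewrite rmorphB /= pq2 subrr.
have := limg_ker_dim psi {: dhomog n.+1 K k.+1}; rewrite capfv.
suff -> : limg psi = fullv by rewrite [X in (_ + X)%N]dimvf /dim /= mul1n.
apply/vspaceP => v; rewrite memvf.
have [|q hq pq] := @pull_surj _ _ A k.+1 (rVpoly v) uA.
  by rewrite (leq_trans (size_poly _ _)) //; nia.
apply/memv_imgP; exists (DHomog hq); rewrite ?memvf // lfunE /= /pull_mod /= pq.
by rewrite modp_small ?rVpolyK // sz_h ltnS size_poly.
Qed.

End Backward.
End IntersectionDegree.

(** * Polynomial functions of frames *)

Section PolynomialFunctions.
Variables (K : closedFieldType) (n : nat) (I : finType) (d : I -> nat).
Notation X := (frames K n d).
Implicit Types (phi psi : X -> K) (e : X).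

Definition polyfun phi :=
  exists f : {mpoly K[#|frame_coord n d|]}, forall e, phi e = frame_eval f e.

Lemma eq_polyfun phi psi : phi =1 psi -> polyfun phi -> polyfun psi.
Proof. by move=> eq_fg [f fE]; exists f => e; rewrite -eq_fg. Qed.

Lemma polyfunC c : polyfun (fun=> c).
Proof. by exists c%:MP => e; rewrite /frame_eval mevalC. Qed.

Lemma polyfun_coord x k j : polyfun (fun e => tnth (e x) k 0 j).
Proof.
exists 'X_(enum_rank (Tagged (fun i => ('I_(d i) * 'I_n.+1)%type) (k, j))) => e.
by rewrite /frame_eval mevalXU /= enum_rankK.
Qed.

Lemma polyfunD phi psi : polyfun phi -> polyfun psi -> polyfun (fun e => phi e + psi e).
Proof.
by move=> [f fE] [g gE]; exists (f + g) => e; rewrite /frame_eval mevalD fE gE.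
Qed.

Lemma polyfunM phi psi : polyfun phi -> polyfun psi -> polyfun (fun e => phi e * psi e).
Proof.
by move=> [f fE] [g gE]; exists (f * g) => e; rewrite /frame_eval mevalM fE gE.
Qed.

Lemma polyfunN phi : polyfun phi -> polyfun (fun e => - phi e).
Proof. by move=> [f fE]; exists (- f) => e; rewrite /frame_eval mevalN fE. Qed.

Lemma polyfunB phi psi : polyfun phi -> polyfun psi -> polyfun (fun e => phi e - psi e).
Proof. by move=> hf hg; apply: polyfunD => //; exact: polyfunN. Qed.

Lemma polyfun_sum J (r : seq J) (P : pred J) (F : J -> X -> K) :
  (forall i, P i -> polyfun (F i)) -> polyfun (fun e => \sum_(i <- r | P i) F i e).
Proof.
move=> FP; elim: r => [|i r IH].
  by apply: eq_polyfun (polyfunC 0) => e; rewrite big_nil.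
case Pi: (P i); last by apply: eq_polyfun IH => e; rewrite big_cons Pi.
by apply: eq_polyfun (polyfunD (FP i Pi) IH) => e; rewrite big_cons Pi.
Qed.

Lemma polyfun_prod J (r : seq J) (P : pred J) (F : J -> X -> K) :
  (forall i, P i -> polyfun (F i)) -> polyfun (fun e => \prod_(i <- r | P i) F i e).
Proof.
move=> FP; elim: r => [|i r IH].
  by apply: eq_polyfun (polyfunC 1) => e; rewrite big_nil.
case Pi: (P i); last by apply: eq_polyfun IH => e; rewrite big_cons Pi.
by apply: eq_polyfun (polyfunM (FP i Pi) IH) => e; rewrite big_cons Pi.
Qed.

Lemma polyfun_det m (M : X -> 'M[K]_m) :
  (forall i j, polyfun (fun e => M e i j)) -> polyfun (fun e => \det (M e)).
Proof.
move=> MP; apply: polyfun_sum => s _; apply: polyfunM; first exact: polyfunC.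
exact: polyfun_prod.
Qed.

Lemma polyfun_adj m (M : X -> 'M[K]_m) i j :
  (forall i j, polyfun (fun e => M e i j)) -> polyfun (fun e => (\adj (M e)) i j).
Proof.
move=> MP; apply: (@eq_polyfun (fun e => cofactor (M e) j i)).
  by move=> e; rewrite mxE.
apply: polyfunM; first exact: polyfunC.
apply: polyfun_det => k l; apply: eq_polyfun (MP (lift j k) (lift i l)) => e.
by rewrite !mxE.
Qed.

Lemma polyfun_mulmx m p q (M : X -> 'M[K]_(m, p)) (N : X -> 'M[K]_(p, q)) i j :
  (forall i j, polyfun (fun e => M e i j)) ->
  (forall i j, polyfun (fun e => N e i j)) -> polyfun (fun e => (M e *m N e) i j).
Proof.
move=> MP NP; apply: (@eq_polyfun (fun e => \sum_k M e i k * N e k j)).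
  by move=> e; rewrite mxE.
by apply: polyfun_sum => k _; apply: polyfunM.
Qed.

Lemma polyfun_comp (T : X -> X) phi :
    (forall x k j, polyfun (fun e => tnth (T e x) k 0 j)) -> polyfun phi ->
  polyfun (fun e => phi (T e)).
Proof.
move=> TP [f fE]; pose u (c : 'I_#|frame_coord n d|) : frame_coord n d := enum_val c.
have /fin_all_exists[g gE] (c : 'I_#|frame_coord n d|) :
    exists g, forall e, tnth (T e (tag (u c))) (tagged (u c)).1 0 (tagged (u c)).2 = frame_eval g e.
  exact: TP.
exists (f \mPo [tuple g c | c < #|frame_coord n d|]) => e.
rewrite fE /frame_eval comp_mpoly_meval; apply: meval_eq => c.
by rewrite tnth_mktuple -[RHS]/(frame_eval (g c) e) -gE.
Qed.

(** Irreducibility of affine space: on the line joining [e1] to [e2] both functions are nonzero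
    polynomials in one variable, so their product has a non-root. *)
Lemma polyfun_nonzero2 phi psi e1 e2 :
    polyfun phi -> polyfun psi -> phi e1 != 0 -> psi e2 != 0 ->
  exists e, phi e != 0 /\ psi e != 0.
Proof.
pose line x : X := fun i => [tuple tnth (e1 i) k + x *: (tnth (e2 i) k - tnth (e1 i) k) | k < d i].
have lineP phi' : polyfun phi' -> exists p : {poly K}, forall x, phi' (line x) = p.[x].
  move=> [f fE]; pose u (c : 'I_#|frame_coord n d|) : frame_coord n d := enum_val c.
  pose w e (c : 'I_#|frame_coord n d|) := tnth (e (tag (u c))) (tagged (u c)).1 0 (tagged (u c)).2.
  exists (mmap polyC (fun c => (w e1 c)%:P + 'X * (w e2 c - w e1 c)%:P) f) => x.
  rewrite fE /frame_eval /mmap mevalE horner_sum; apply: eq_bigr => m _.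
  rewrite hornerM hornerC /mmap1 horner_prod; congr (_ * _); apply: eq_bigr => c _.
  rewrite horner_exp hornerD hornerM !hornerC hornerX /= /line tnth_mktuple.
  by rewrite !mxE.
have line0 phi' : polyfun phi' -> phi' (line 0) = phi' e1.
  move=> [f fE]; rewrite !fE; apply: meval_eq => c /=.
  by rewrite tnth_mktuple scale0r addr0.
have line1 phi' : polyfun phi' -> phi' (line 1) = phi' e2.
  move=> [f fE]; rewrite !fE; apply: meval_eq => c /=.
  by rewrite tnth_mktuple scale1r addrCA subrr addr0.
move=> fP gP f1 g2; have [p pE] := lineP _ fP; have [q qE] := lineP _ gP.
have p0 : p != 0.
  by apply: contraNneq f1 => p0; rewrite -(line0 _ fP) pE p0 horner0.
have q0 : q != 0.
  by apply: contraNneq g2 => q0; rewrite -(line1 _ gP) qE q0 horner0.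
have [s [us ss _]] := closed_field_fresh_uniq (K := K) [::] (size (p * q)).
have /allPn[x _] : ~~ all (root (p * q)) s.
  apply/negP => rs; have := mulf_neq0 p0 q0.
  by rewrite (roots_geq_poly_eq0 rs us) ?ss ?eqxx.
rewrite rootE hornerM mulf_eq0 negb_or -pE -qE => /andP[px qx].
by exists (line x).
Qed.

Lemma polyfun_nonzero_seq J (r : seq J) (F : J -> X -> K) :
    (forall i, polyfun (F i)) -> (forall i, exists e, F i e != 0) ->
  exists e, \prod_(i <- r) F i e != 0.
Proof.
move=> FP Fnz; elim: r => [|i r [e IH]].
  by exists (fun i => nseq_tuple (d i) 0); rewrite big_nil oner_neq0.
have [e' Fe'] := Fnz i.
have [e'' [h1 h2]] := polyfun_nonzero2 (FP i) (polyfun_prod r (fun j _ => FP j)) Fe' IH.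
by exists e''; rewrite big_cons mulf_neq0.
Qed.

Section ChangeOfFrames.
Variable g : forall x, 'M[K]_(d x).

Definition change_frames e : X :=
  fun x => [tuple \sum_l g x k l *: tnth (e x) l | k < d x].

Lemma tnth_change_frames e x k :
  tnth (change_frames e x) k = \sum_l g x k l *: tnth (e x) l.
Proof. by rewrite tnth_mktuple. Qed.

Lemma sum_change_frames e x (c : 'rV[K]_(d x)) :
  \sum_k c 0 k *: tnth (change_frames e x) k
    = \sum_l (c *m g x) 0 l *: tnth (e x) l.
Proof.
under eq_bigr do rewrite tnth_change_frames scaler_sumr.
rewrite exchange_big; apply: eq_bigr => l _; rewrite mxE scaler_suml.
by apply: eq_bigr => k _; rewrite scalerA.
Qed.

Lemma polyfun_change_frames phi :
  polyfun phi -> polyfun (fun e => phi (change_frames e)).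
Proof.
apply: polyfun_comp => x k j.
apply: (@eq_polyfun (fun e => \sum_l g x k l * tnth (e x) l 0 j)).
  move=> e; rewrite tnth_change_frames summxE.
  by apply: eq_bigr => l _; rewrite mxE.
apply: polyfun_sum => l _; apply: polyfunM; first exact: polyfunC.
exact: polyfun_coord.
Qed.

Lemma frameP e x :
  reflect (forall c : 'rV_(d x), \sum_k c 0 k *: tnth (e x) k = 0 -> c = 0)
          (free (e x)).
Proof.
apply: (iffP (@freeP _ _ _ (e x))) => [fe c c0|fe c c0 i].
  apply/rowP => k; rewrite mxE (fe (fun k => c 0 k)) //.
  by rewrite -[RHS]c0; apply: eq_bigr => i _; rewrite (tnth_nth 0).
suff /rowP/(_ i) : \row_k c k = 0 by rewrite !mxE.
apply: fe; rewrite -[RHS]c0; apply: eq_bigr => k _.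
by rewrite mxE (tnth_nth 0).
Qed.

Lemma change_frames_basis L e : (forall x, g x \in unitmx) ->
  frame_of L e -> frame_of L (change_frames e).
Proof.
move=> ug Le x; have := Le x; rewrite !basisEfree !size_tuple.
move=> /and3P[/frameP fe /span_subvP se ->]; rewrite andbT; apply/andP; split.
  apply/frameP => c; rewrite sum_change_frames => /fe /(canRL (mulmxK (ug x))).
  by rewrite mul0mx.
apply/span_subvP => _ /tnthP[k ->]; rewrite tnth_change_frames.
by apply: rpred_sum => l _; apply: rpredZ; apply: se; exact: mem_tnth.
Qed.

End ChangeOfFrames.

Lemma frames_of_same L e e' : frame_of L e -> frame_of L e' ->
  exists g : forall x, 'M[K]_(d x), (forall x, g x \in unitmx) /\
    forall x, change_frames g e x = e' x.
Proof.
move=> Le Le'; pose g x := \matrix_(k, l) coord (e x) l (tnth (e' x) k) : 'M[K]_(d x).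
have gE x : change_frames g e x = e' x.
  apply: eq_from_tnth => k; rewrite tnth_change_frames.
  have Lk : tnth (e' x) k \in L x by rewrite (basis_mem (Le' x)) // mem_tnth.
  rewrite [RHS](coord_basis (Le x) Lk).
  by apply: eq_bigr => l _; rewrite mxE [tnth (e x) l](tnth_nth 0).
exists g; split=> // x; rewrite -row_free_unit; apply: inj_row_free => c c0.
have /basis_free/frameP := Le' x; apply; rewrite -gE sum_change_frames c0.
by rewrite big1 // => l _; rewrite mxE scale0r.
Qed.

Lemma eq_polyfun_frames phi e e' : polyfun phi -> (forall x, e x = e' x) -> phi e = phi e'.
Proof. by move=> [f fE] ee; rewrite !fE; apply: meval_eq => c /=; rewrite ee. Qed.

Lemma free_witness : (forall x, d x <= n.+1)%N ->
  exists2 psi, polyfun psi & (exists e, psi e != 0) /\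
    forall e, psi e != 0 -> forall x, free (e x).
Proof.
move=> dn; pose minor x e := \det (\matrix_(k < d x, l < d x) tnth (e x) k 0 (inord l)).
have minorP x : polyfun (minor x).
  apply: polyfun_det => k l.
  by apply: eq_polyfun (polyfun_coord k (inord l)) => e; rewrite mxE.
exists (fun e => \prod_(x <- index_enum I) minor x e); first exact: polyfun_prod.
split.
  apply: polyfun_nonzero_seq => // x.
  exists (fun y => [tuple \row_j (j == k :> nat)%:R | k < d y]).
  rewrite /minor (_ : \matrix_(_, _) _ = 1%:M) ?det1 ?oner_neq0 //.
  apply/matrixP => k l; rewrite mxE tnth_mktuple !mxE inordK; last exact: leq_trans (dn x).
  by rewrite eq_sym.
move=> e; rewrite prodf_seq_neq0 => /allP /= nz x; apply/frameP => c c0.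
have := nz x (mem_index_enum x); rewrite -unitfE -unitmxE => uM.
apply: (can_inj (mulmxK uM)); rewrite mul0mx; apply/rowP => l.
have /rowP/(_ (inord l)) := c0; rewrite summxE [RHS]mxE => cl.
rewrite [RHS]mxE [LHS]mxE -[RHS]cl.
by apply: eq_bigr => k _; rewrite !mxE.
Qed.

(** The condition on [phi] may depend on the frame, so the open set consists of the tuples having
    some good frame. Seen from a fixed frame it is the union, over all changes of frame, of loci
    where a polynomial is nonzero. *)
Lemma for_generic_polyfun Q phi e0 : (forall x, d x <= n.+1)%N ->
    polyfun phi -> phi e0 != 0 ->
    (forall L e, frame_of L e -> phi e != 0 -> Q L) ->
  for_generic d Q.
Proof.
move=> dn phiP phi0 phiQ.
exists (fun L => exists2 e, frame_of L e & phi e != 0); split.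
- exists (fun f => exists2 g : forall x, 'M[K]_(d x), (forall x, g x \in unitmx)
      & forall e, frame_eval f e = phi (change_frames g e)) => L e Le; split.
    move=> [e' Le' phie']; have [g [ug gE]] := frames_of_same Le Le'.
    have [f fE] := polyfun_change_frames g phiP; exists f; first by exists g.
    by rewrite -fE (eq_polyfun_frames phiP gE).
  move=> [f [g ug fE] fe]; exists (change_frames g e); last by rewrite -fE.
  exact: change_frames_basis.
(* [e0] may fail to be a frame; a common non-zero of [phi] and [psi] is one. *)
- have [psi psiP [[e1 psi1] psiF]] := free_witness dn.
  have [e [phie psie]] := polyfun_nonzero2 phiP psiP phi0 psi1.
  exists (fun x => <<e x>>%VS) => [x|].
    by have /eqP -> := psiF _ psie x; rewrite size_tuple.
  by exists e => // x; rewrite /basis_of eqxx psiF.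
- by move=> L _ [e Le phie]; exact: phiQ Le phie.
Qed.

End PolynomialFunctions.

(** * The cross-ratio obstruction *)

Section Determinants.
Variable F : fieldType.

Lemma det_col_mx_row_op p q (M : 'M[F]_p) (Z : 'M_(p, q)) (N : 'M_(p, p + q))
    (u : 'M_(q, p + q)) :
  \det (col_mx (M *m N + Z *m u) u) = \det M * \det (col_mx N u).
Proof.
have -> : col_mx (M *m N + Z *m u) u = block_mx M Z 0 1%:M *m col_mx N u.
  by rewrite mul_block_col mul0mx mul1mx add0r.
by rewrite det_mulmx det_ublock det1 mulr1.
Qed.

(** [g] is a projection killing the rows of [u]. In a basis adapted to [g] the stacked matrix is
    block triangular, with [N *m g] giving one diagonal block up to an invertible factor. *)
Lemma det_col_mx_kernel p q (g : 'M[F]_(p + q, p)) (u : 'M_(q, p + q)) :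
    \rank g = p -> u *m g = 0 ->
  exists k, forall N : 'M_(p, p + q), \det (col_mx N u) = k * \det (N *m g).
Proof.
move=> rg ug; set E := col_ebase g; set U := row_ebase g.
have uE : E \in unitmx by exact: col_ebase_unit.
have uU : U \in unitmx by exact: row_ebase_unit.
have gE : g = lsubmx E *m U.
  rewrite -{1}[g]mulmx_ebase -/E -/U rg -{1}[E]hsubmxK.
  have -> : pid_mx p = col_mx 1%:M 0 :> 'M[F]_(p + q, p).
    apply/matrixP => i j; rewrite !mxE; case: splitP => k ik; rewrite !mxE ik.
      by rewrite andbT.
    by rewrite andbF.
  by rewrite mul_row_col mulmx0 addr0 mulmx1.
have uL : u *m lsubmx E = 0.
  by apply: (can_inj (mulmxK uU)); rewrite mul0mx -mulmxA -gE.
exists (\det (u *m rsubmx E) / (\det E * \det U)) => N.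
have nE : \det E != 0 by rewrite -unitfE -unitmxE.
have nU : \det U != 0 by rewrite -unitfE -unitmxE.
have := det_mulmx (col_mx N u) E.
rewrite -{1}[E]hsubmxK mul_col_row uL det_ublock gE mulmxA det_mulmx => e.
apply: (mulIf nE); rewrite -e; field; exact/andP.
Qed.

Lemma det_mx2 (M : 'M[F]_2) : \det M = M 0 0 * M 1 1 - M 0 1 * M 1 0.
Proof.
rewrite (expand_det_row _ 0) !big_ord_recl big_ord0 addr0 /cofactor !det_mx11 !mxE /=.
by rewrite expr0 mul1r expr1 mulN1r mulrN; congr (_ * M _ _ - M _ _ * M _ _); apply: val_inj.
Qed.

Lemma det_col_mx2 (x y : 'rV[F]_2) :
  \det (col_mx x y : 'M_2) = x 0 0 * y 0 1 - x 0 1 * y 0 0.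
Proof.
have e0 j : (col_mx x y : 'M_2) 0 j = x 0 j.
  by rewrite mxE; case: splitP => k //; rewrite ord1.
have e1 j : (col_mx x y : 'M_2) 1 j = y 0 j.
  by rewrite mxE; case: splitP => k //; rewrite ord1.
by rewrite det_mx2 !e0 !e1.
Qed.

End Determinants.

Section FrameVectors.
Variables (K : closedFieldType) (n : nat) (I : finType) (d : I -> nat).
Notation X := (frames K n d).
Notation index := {i : I & 'I_(d i)}.

Definition frame_vec (e : X) (z : index) : 'rV[K]_n.+1 := tnth (e (tag z)) (tagged z).

Definition vec_mx m (f : 'I_m -> index) (e : X) : 'M[K]_(m, n.+1) :=
  \matrix_(i < m) frame_vec e (f i).

Lemma polyfun_vec_mx m (f : 'I_m -> index) i j : polyfun (fun e => vec_mx f e i j).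
Proof.
by apply: eq_polyfun (polyfun_coord K (tagged (f i)) j) => e; rewrite mxE.
Qed.

Lemma det_vec_mx_nonzero (f : 'I_n.+1 -> index) : injective f ->
  exists e, \det (vec_mx f e) != 0.
Proof.
move=> fI; pose w z : 'rV[K]_n.+1 := if [pick i | f i == z] is Some i then delta_mx 0 i else 0.
exists (fun x => [tuple w (Tagged (fun i => 'I_(d i)) k) | k < d x]).
rewrite (_ : vec_mx _ _ = 1%:M) ?det1 ?oner_neq0 //.
apply/row_matrixP => i; rewrite rowK row1 /frame_vec tnth_mktuple /w.
case: pickP => [j|/(_ i)]; rewrite taggedK; last by rewrite eqxx.
by move=> /eqP /fI ->.
Qed.

Definition set_vec (e : X) (z : index) (v : 'rV[K]_n.+1) : X :=
  fun x => [tuple if Tagged (fun i => 'I_(d i)) k == z then v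
                  else tnth (e x) k | k < d x].

Lemma frame_vec_set e z v z' :
  frame_vec (set_vec e z v) z' = if z' == z then v else frame_vec e z'.
Proof. by rewrite /frame_vec tnth_mktuple; case: z'. Qed.

End FrameVectors.

Section CrossRatioObstruction.
Variables (K : closedFieldType) (q : nat) (I : finType) (d : I -> nat).
Notation n := q.+1.
Notation X := (frames K n d).
Notation index := {i : I & 'I_(d i)}.
Notation V := 'rV[K]_n.+1.

Lemma enum_frame_vecs (Xs : {set I}) : (\sum_(x in Xs) d x)%N = q ->
  exists rho : 'I_q -> index,
    [/\ injective rho, forall i, tag (rho i) \in Xs
      & forall z, tag z \in Xs -> exists i, rho i = z].
Proof.
move=> sXs; pose T := [set z : index | tag z \in Xs].
have cT : #|T| = q.
  rewrite -sum1_card -sXs; under [RHS]eq_bigr do rewrite -[d _]card_ord -sum1_card.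
  rewrite sig_big_dep; apply: eq_bigl => z; by rewrite inE andbT.
exists (fun i => enum_val (cast_ord (esym cT) i)); split=> [i j|i|z zXs].
- by move=> /enum_val_inj/cast_ord_inj.
- by have := enum_valP (cast_ord (esym cT) i); rewrite inE.
have zT : z \in T by rewrite inE.
by exists (cast_ord cT (enum_rank_in zT z)); rewrite cast_ordK enum_rankK_in.
Qed.

(** Up to a constant, the determinant of the images of v and w in P^1 under projection from the span
    of the rows of u. *)
Definition det_pair (u : 'M[K]_(q, n.+1)) (v w : V) : K :=
  \det (col_mx (col_mx v w : 'M_(2, 2 + q)) u).

Lemma det_pair_polyfun (rho : 'I_q -> index) a b :
  polyfun (fun e : X => det_pair (vec_mx rho e) (frame_vec e a) (frame_vec e b)).
Proof.
apply: polyfun_det => i j; apply: (@eq_polyfun _ _ _ _ (fun e : X =>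
    match split (i : 'I_(2 + q)) with
    | inl k => match split (k : 'I_(1 + 1)) with
               | inl _ => frame_vec e a 0 j | inr _ => frame_vec e b 0 j end
    | inr k => vec_mx rho e k j end)).
  move=> e; rewrite [RHS]mxE; case: split => k //; rewrite [RHS]mxE.
  by case: split => k'; rewrite ord1.
case: split => [k|k]; last exact: polyfun_vec_mx.
by case: split => _; exact: polyfun_coord.
Qed.

Lemma det_pair_nonzero (rho : 'I_q -> index) a b : injective rho -> a != b ->
    (forall i, rho i != a) -> (forall i, rho i != b) ->
  exists e : X, det_pair (vec_mx rho e) (frame_vec e a) (frame_vec e b) != 0.
Proof.
move=> rI ab ra rb.
pose f (i : 'I_(2 + q)) := match split i with
    | inl k => match split (k : 'I_(1 + 1)) with inl _ => a | inr _ => b end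
    | inr k => rho k end.
have fI : injective f.
  move=> x y; rewrite /f => fxy; rewrite -[x]splitK -[y]splitK; move: fxy.
  case: (split x) => k; case: (split y) => l.
  - move=> fij; rewrite -[k](@splitK 1 1) -[l](@splitK 1 1); move: fij.
    case: (split (k : 'I_(1 + 1))) => k'; case: (split (l : 'I_(1 + 1))) => l'.
    + by rewrite !ord1.
    + by move/eqP: ab.
    + by move/esym/eqP; rewrite (negbTE ab).
    + by rewrite !ord1.
  - case: split => _ e; first by have := ra l; rewrite -e eqxx.
    by have := rb l; rewrite -e eqxx.
  - case: split => _ e; first by have := ra k; rewrite e eqxx.
    by have := rb k; rewrite e eqxx.
  - by move/rI ->.
have [e fe] := @det_vec_mx_nonzero K _ _ _ (f : 'I_n.+1 -> _) fI.
exists e; rewrite /det_pair (_ : col_mx _ _ = vec_mx f e) //.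
apply/matrixP => i j; rewrite [LHS]mxE [RHS]mxE /f; case: split => k.
  by rewrite mxE; case: split => k'; rewrite ord1.
by rewrite mxE.
Qed.

Lemma det_pair_row_op (u : 'M[K]_(q, n.+1)) (a b c c' : K) (r r' : 'rV[K]_q) v w :
  det_pair u (a *: v + b *: w + r *m u) (c *: v + c' *: w + r' *m u)
    = (a * c' - b * c) * det_pair u v w.
Proof.
pose M : 'M[K]_(1 + 1) := block_mx a%:M b%:M c%:M c'%:M.
have <- : \det M = a * c' - b * c.
  have s1 (x : K) : (x%:M : 'M_1) 0 0 = x by rewrite mxE mulr1n.
  have e00 : M (lshift 1 0) (lshift 1 0) = a := etrans (block_mxEul _ _ _ _ _ _) (s1 _).
  have e01 : M (lshift 1 0) (rshift 1 0) = b := etrans (block_mxEur _ _ _ _ _ _) (s1 _).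
  have e10 : M (rshift 1 0) (lshift 1 0) = c := etrans (block_mxEdl _ _ _ _ _ _) (s1 _).
  have e11 : M (rshift 1 0) (rshift 1 0) = c' := etrans (block_mxEdr _ _ _ _ _ _) (s1 _).
  rewrite -e00 -e01 -e10 -e11 det_mx2.
  by congr (M _ _ * M _ _ - M _ _ * M _ _); apply: val_inj.
apply: etrans (det_col_mx_row_op M (col_mx r r') (col_mx v w) u).
have eM := mul_block_col a%:M b%:M c%:M c'%:M v w.
rewrite !mul_scalar_mx in eM.
by congr (\det (col_mx _ _)); rewrite /M eM mul_col_mx add_col_mx.
Qed.

Section Feasible.
Variables (A : 'M[K]_n.+1) (L : I -> {vspace V}) (h : I -> {poly K}) (e : X).
Hypotheses (uA : A \in unitmx) (Le : frame_of L e).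
Hypothesis h0 : forall x, h x != 0.
Hypothesis size_h : forall x, (size (h x) <= (d x).+1)%N.
Hypothesis dn : forall x, (d x <= n)%N.
Hypothesis annih_h : forall x (f : {poly K}),
  (size f <= n.+1 - d x)%N -> annih A (L x) (h x * f).

(** The projection from the components in [Xs] is given on the curve by (G : G X), that is, by the
    parameter. The determinant is thus the resultant of the two linear divisors, up to one weight
    per point and a constant of the centre. *)
Lemma det_pair_feasible (Xs : {set I}) (rho : 'I_q -> index) :
    (\sum_(x in Xs) d x)%N = q -> (forall i, tag (rho i) \in Xs) ->
  exists k (w : index -> K), forall a b, d (tag a) = 1%N -> d (tag b) = 1%N ->
    det_pair (vec_mx rho e) (frame_vec e a) (frame_vec e b)
      = k * (w a * w b * ((h (tag a))`_0 * (h (tag b))`_1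
                         - (h (tag a))`_1 * (h (tag b))`_0)).
Proof.
move=> sXs rXs; pose G := \prod_(x in Xs) h x.
have sizeP (Ys : {set I}) : (size (\prod_(x in Ys) h x)%R <= (\sum_(x in Ys) d x).+1)%N.
  apply: (big_ind2 (fun (f : {poly K}) k => (size f <= k.+1)%N)) => //.
    by rewrite size_poly1.
  by move=> f k g l fk gl; exact: size_polyM_leq.
have G0 : G != 0 by apply/prodf_neq0.
have szG : (size G <= n)%N by rewrite -sXs; exact: sizeP.
have szGX : (size (G * 'X)%R <= n.+1)%N by rewrite size_mulX.
have memL z : frame_vec e z \in L (tag z).
  by rewrite (basis_mem (Le (tag z))) // mem_tnth.
pose T := lin1_mx (@mulp_row K 2 n.+1 G).
have szGT : (size G + 2 <= n.+2)%N by rewrite addn2 !ltnS.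
pose Gm : 'M[K]_(2 + q, 2) := invmx A *m T^T.
have rG : \rank Gm = 2%N.
  rewrite /Gm eqmxMfull ?row_full_unit ?unitmx_inv // mxrank_tr; apply/eqP; rewrite -/(row_free _).
  apply: inj_row_free => c; rewrite mul_rV_lin1 /= -[RHS](linear0 (@mulp_row K 2 n.+1 G)).
  exact: mulp_row_inj.
have GmE (v : V) k : (v *m Gm) 0 k = (v *m lift_poly A (G * 'X^k)) 0 0.
  rewrite /Gm /lift_poly !mulmxA [LHS]mxE [RHS]mxE; apply: eq_bigr => i _.
  by congr (_ * _); rewrite !mxE /= /mulp_row rVpoly_delta.
have kill z k : tag z \in Xs -> (frame_vec e z *m Gm) 0 k = 0.
  move=> zX; rewrite GmE /G (big_setD1 _ zX) /= -mulrA.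
  have [|_ ->] := annih_h (x := tag z) (f := \prod_(x in Xs :\ tag z) h x * 'X^k); last 2 first.
  - by rewrite mxE.
  - exact: memL.
  apply: leq_trans (size_polyM_leq (sizeP _) (_ : _ <= 2)%N) _.
    by rewrite size_polyXn.
  have := sXs; rewrite (big_setD1 _ zX) /=; move: (\sum_(_ in _) _)%N (d _) => y y'.
  lia.
have uG : vec_mx rho e *m Gm = 0.
  apply/row_matrixP => i; rewrite row_mul rowK row0; apply/rowP => k.
  by rewrite kill // mxE.
have [k kE] := det_col_mx_kernel rG uG.
have /fin_all_exists[w wE] (a : index) : exists w : K, d (tag a) = 1%N ->
    (frame_vec e a *m Gm) 0 0 = w * (h (tag a))`_1 /\
    (frame_vec e a *m Gm) 0 1 = - (w * (h (tag a))`_0).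
  have [da|da] := eqVneq (d (tag a)) 1%N; last by exists 0 => /eqP; rewrite (negbTE da).
  set v := frame_vec e a; set f := h (tag a).
  have fE : f = f`_0 *: 1 + f`_1 *: 'X.
    apply/polyP => -[|[|j]]; rewrite !coefE ?mulr1 ?mulr0 ?addr0 ?add0r //.
    by apply: nth_default; rewrite (leq_trans (size_h _)) // da.
  have : f`_0 * (v *m Gm) 0 0 + f`_1 * (v *m Gm) 0 1 = 0.
    have [|_ /(_ v (memL a))] := annih_h (x := tag a) (f := G).
      by rewrite da subn1.
    have liftE x y g1 g2 : lift_poly A (x *: g1 + y *: g2)
        = x *: lift_poly A g1 + y *: lift_poly A g2.
      by rewrite /lift_poly linearD /= 2!linearZ /= linearD /= 2!linearZ /= mulmxDr -!scalemxAr.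
    rewrite -/f [f * G](_ : _ = f`_0 *: G + f`_1 *: (G * 'X)); last first.
      by rewrite {1}fE mulrDl -!scalerAl mul1r ['X * G]mulrC.
    rewrite liftE mulmxDr -!scalemxAr.
    move=> /matrixP/(_ 0 0); rewrite mxE [X in X + _]mxE [X in _ + X]mxE [RHS]mxE.
    by rewrite !GmE expr0 mulr1 expr1.
  move: (_ 0 0) (_ 0 1) => x y fxy; have [f1|f1] := eqVneq f`_1 0.
    have f0 : f`_0 != 0.
      by apply: contraNneq (h0 (tag a)) => f0; rewrite -/f fE f0 f1 !scale0r addr0.
    exists (- y / f`_0) => _; rewrite f1 mulr0 divfK // opprK; split=> //.
    by move: fxy; rewrite f1 mul0r addr0 => /eqP; rewrite mulf_eq0 (negbTE f0) => /eqP.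
  exists (x / f`_1) => _; rewrite divfK //; split=> //.
  apply: (mulfI f1); move: fxy => /eqP; rewrite addrC addr_eq0 => /eqP ->.
  by field.
exists k, w => a b da db; rewrite /det_pair kE.
rewrite [X in \det X](mul_col_mx (frame_vec e a) (frame_vec e b) Gm) det_col_mx2.
have [-> ->] := wE a da; have [-> ->] := wE b db; ring.
Qed.

End Feasible.

(** Equality of the cross ratios seen from two centres, with denominators cleared so that it makes
    sense for degenerate configurations too. *)
Definition cross_ratio_poly (rho rho' : 'I_q -> index) (p0 p1 k1 k2 : index) (e : X) :=
  let D a b := det_pair (vec_mx rho e) (frame_vec e a) (frame_vec e b) in
  let D' a b := det_pair (vec_mx rho' e) (frame_vec e a) (frame_vec e b) in
  D k1 p1 * D p0 k2 * (D' p0 k1 * D' k2 p1)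
    - D p0 k1 * D k2 p1 * (D' k1 p1 * D' p0 k2).

Lemma cross_ratio_polyfun rho rho' p0 p1 k1 k2 :
  polyfun (cross_ratio_poly rho rho' p0 p1 k1 k2).
Proof.
by apply: polyfunB; (apply: polyfunM; apply: polyfunM); exact: det_pair_polyfun.
Qed.

Lemma feasible_cross_ratio L e (Xs Xs' : {set I}) rho rho' p0 p1 k1 k2 :
    (forall x, d x <= n)%N -> frame_of L e ->
    (\sum_(x in Xs) d x)%N = q -> (forall i, tag (rho i) \in Xs) ->
    (\sum_(x in Xs') d x)%N = q -> (forall i, tag (rho' i) \in Xs') ->
    d (tag p0) = 1%N -> d (tag p1) = 1%N -> d (tag k1) = 1%N -> d (tag k2) = 1%N ->
  feasible L -> cross_ratio_poly rho rho' p0 p1 k1 k2 e = 0.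
Proof.
move=> dn Le sX rX sX' rX' d0 d1 dk1 dk2 [C [A uA CE] CL].
have dL x : \dim (L x) = d x by rewrite (vector.size_basis (Le x)).
have /fin_all_exists[h hP] (x : I) : exists h : {poly K}, [/\ h != 0, (size h <= (d x).+1)%N &
    forall f : {poly K}, (size f <= n.+1 - d x)%N -> annih A (L x) (h * f)].
  by rewrite -dL; apply: (intersection_degree_divisor uA CE) => //; rewrite dL.
have h0 x : h x != 0 by have [] := hP x.
have hs x : (size (h x) <= (d x).+1)%N by have [] := hP x.
have ha x f : (size (f : {poly K}) <= n.+1 - d x)%N -> annih A (L x) (h x * f).
  by have [_ _] := hP x; apply.
have [k [w E]] := det_pair_feasible uA Le h0 hs ha sX rX.
have [k' [w' E']] := det_pair_feasible uA Le h0 hs ha sX' rX'.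
(* Each of the four points occurs once in each product of two determinants from the same centre, so
   both terms carry the same weights. *)
rewrite /cross_ratio_poly !E ?E' //; ring.
Qed.

(* The witness makes the point [k1] equal to [p0] plus the frame vector [z],  *)
(* which lies in the span of the first family but not in that of the second:  *)
(* this kills one of the two products and not the other.                      *)
Lemma cross_ratio_nonzero (Xs Xs' : {set I}) rho rho' p0 p1 k1 k2 z :
    injective rho -> (forall i, tag (rho i) \in Xs) ->
    injective rho' -> (forall i, tag (rho' i) \in Xs') ->
    (exists i, rho i = z) -> tag z \notin Xs' ->
    uniq [:: p0; p1; k1; k2] ->
    (forall p, p \in [:: p0; p1; k1; k2] -> (tag p \notin Xs) && (tag p \notin Xs')) ->
  exists e, cross_ratio_poly rho rho' p0 p1 k1 k2 e != 0.
Proof.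
move=> rI rX rI' rX' [iz rz] zX' up pX.
have neq p i : p \in [:: p0; p1; k1; k2] -> rho i != p.
  by move=> /pX/andP[pX1 _]; apply: contraNneq pX1 => <-.
have neq' p i : p \in [:: p0; p1; k1; k2] -> rho' i != p.
  by move=> /pX/andP[_ pX1]; apply: contraNneq pX1 => <-.
have nz p : p \in [:: p0; p1; k1; k2] -> p != z.
  by move=> hp; have := neq p iz hp; rewrite rz eq_sym.
have nz' i : rho' i != z by apply: contraNneq zX' => <-.
have /and4P[/norP[p01 /norP[p0k1 p0k2]] /norP[p1k1 p1k2] k12 _] :
    [&& ~~ [|| p0 == p1, p0 == k1 | p0 == k2], ~~ ((p1 == k1) || (p1 == k2)), k1 != k2 & true].
  by move: up; rewrite /= !inE => /and4P[-> -> -> _].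
have m0 : p0 \in [:: p0; p1; k1; k2] by rewrite !inE eqxx.
have m1 : p1 \in [:: p0; p1; k1; k2] by rewrite !inE eqxx orbT.
have m3 : k1 \in [:: p0; p1; k1; k2] by rewrite !inE eqxx !orbT.
have m2 : k2 \in [:: p0; p1; k1; k2] by rewrite !inE eqxx !orbT.
pose D r a b (e : X) := det_pair (vec_mx r e) (frame_vec e a) (frame_vec e b).
have DP r a b : polyfun (D r a b) by exact: det_pair_polyfun.
have [e1 [n1 n2]] : exists e, D rho p0 p1 e != 0 /\ D rho p0 k2 e != 0.
  have [e1 f1] := det_pair_nonzero rI p01 (fun i => neq _ i m0) (fun i => neq _ i m1).
  have [e2 f2] := det_pair_nonzero rI p0k2 (fun i => neq _ i m0) (fun i => neq _ i m2).
  exact: polyfun_nonzero2 (DP _ _ _) (DP _ _ _) f1 f2.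
have [e2 [n3 n4]] : exists e, D rho' p0 z e != 0 /\ D rho' k2 p1 e != 0.
  have [e2 f2] := det_pair_nonzero rI' (nz _ m0) (fun i => neq' _ i m0) nz'.
  rewrite eq_sym in p1k2.
  have [e3 f3] := det_pair_nonzero rI' p1k2 (fun i => neq' _ i m2) (fun i => neq' _ i m1).
  exact: polyfun_nonzero2 (DP _ _ _) (DP _ _ _) f2 f3.
have [e []] := polyfun_nonzero2 (polyfunM (DP _ _ _) (DP _ _ _))
  (polyfunM (DP _ _ _) (DP _ _ _)) (mulf_neq0 n1 n2) (mulf_neq0 n3 n4).
rewrite !mulf_eq0 !negb_or => /andP[{}n1 {}n2] /andP[{}n3 {}n4].
exists (set_vec e k1 (frame_vec e p0 + frame_vec e z)); set e' := set_vec _ _ _.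
have vE p : p != k1 -> frame_vec e' p = frame_vec e p.
  by move=> pk; rewrite frame_vec_set (negbTE pk).
have uE : vec_mx rho e' = vec_mx rho e.
  by apply/row_matrixP => i; rewrite !rowK vE // neq.
have uE' : vec_mx rho' e' = vec_mx rho' e.
  by apply/row_matrixP => i; rewrite !rowK vE // neq'.
have zE : frame_vec e z = delta_mx 0 iz *m vec_mx rho e by rewrite -rowE rowK rz.
have vk : frame_vec e' k1 = frame_vec e p0 + frame_vec e z by rewrite frame_vec_set eqxx.
have k21 : k2 != k1 by rewrite eq_sym.
rewrite /cross_ratio_poly uE uE' vk (vE p0) // (vE p1) // (vE k2) //.
set v0 := frame_vec e p0; set v1 := frame_vec e p1; set v2 := frame_vec e k2.
have -> : det_pair (vec_mx rho e) v0 (v0 + frame_vec e z) = 0.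
  have := det_pair_row_op (vec_mx rho e) 1 0 1 0 0 (delta_mx 0 iz) v0 v1.
  by rewrite -zE !scale1r !scale0r mul0mx !addr0 !mulr0 mul0r subrr mul0r.
have -> : det_pair (vec_mx rho e) (v0 + frame_vec e z) v1 = D rho p0 p1 e.
  have := det_pair_row_op (vec_mx rho e) 1 0 0 1 (delta_mx 0 iz) 0 v0 v1.
  by rewrite -zE !scale1r !scale0r mul0mx !addr0 !add0r mulr1 mul0r subr0 mul1r.
have -> : det_pair (vec_mx rho' e) v0 (v0 + frame_vec e z) = D rho' p0 z e.
  have := det_pair_row_op (vec_mx rho' e) 1 0 1 1 0 0 v0 (frame_vec e z).
  by rewrite !scale1r !scale0r mul0mx !addr0 mulr1 mul0r subr0 mul1r.
by rewrite !mul0r subr0; apply: mulf_neq0; apply: mulf_neq0.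
Qed.

Lemma generic_infeasible (Xs Xs' : {set I}) (p0 p1 k1 k2 z : index) :
    (forall x, d x <= n)%N ->
    (\sum_(x in Xs) d x)%N = q -> (\sum_(x in Xs') d x)%N = q ->
    d (tag p0) = 1%N -> d (tag p1) = 1%N -> d (tag k1) = 1%N -> d (tag k2) = 1%N ->
    tag z \in Xs -> tag z \notin Xs' -> uniq [:: p0; p1; k1; k2] ->
    (forall p, p \in [:: p0; p1; k1; k2] -> (tag p \notin Xs) && (tag p \notin Xs')) ->
  for_generic d (fun L : I -> {vspace V} => ~ feasible L).
Proof.
move=> dn sX sX' d0 d1 dk1 dk2 zX zX' up pX.
have [rho [rI rX rz]] := enum_frame_vecs sX.
have [rho' [rI' rX' _]] := enum_frame_vecs sX'.
have [e0 e0P] := cross_ratio_nonzero rI rX rI' rX' (rz _ zX) zX' up pX.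
apply: (for_generic_polyfun _ (cross_ratio_polyfun rho rho' p0 p1 k1 k2) e0P).
  by move=> x; rewrite ltnW // ltnS.
move=> L e Le /eqP eP fL; apply: eP.
exact: feasible_cross_ratio dn Le sX rX sX' rX' d0 d1 dk1 dk2 fL.
Qed.

End CrossRatioObstruction.

(** * Interpolation *)

Section Interpolation.
Variable F : fieldType.
Implicit Types (N : nat) (w t : nat -> F).

Lemma size_prodXsubC_card (T : finType) (P : pred T) (a : T -> F) :
  size (\prod_(k | P k) ('X - (a k)%:P)) = #|P|.+1.
Proof.
have -> : \prod_(k | P k) ('X - (a k)%:P) = \prod_(k <- enum P) ('X - (a k)%:P).
  by rewrite big_enum.
by rewrite size_prod_XsubC -cardE.
Qed.

(* Up to normalisation of the weights, the Lagrange interpolation polynomial  *)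
(* at the nodes [t 0], ..., [t (N - 1)].                                      *)
Definition interp N w t : {poly F} :=
  \sum_(j < N) w j *: \prod_(l < N | l != j) ('X - (t l)%:P).

Lemma size_interp N w t : (size (interp N w t) <= N)%N.
Proof.
apply: leq_trans (size_sum _ _ _) _; apply/bigmax_leqP => j _.
apply: leq_trans (size_scale_leq _ _) _.
rewrite size_prodXsubC_card cardC1 card_ord prednK //.
exact: leq_ltn_trans (ltn_ord j).
Qed.

Lemma horner_interp N w t (j : 'I_N) :
  (interp N w t).[t j] = w j * \prod_(l < N | l != j) (t j - t l).
Proof.
rewrite /interp horner_sum [\sum_(_ < _) _](bigD1 j) //= [\sum_(_ < _ | _) _]big1 ?addr0 => [|i ij].
  by rewrite hornerZ horner_prod; under eq_bigr do rewrite hornerXsubC.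
rewrite hornerZ horner_prod (bigD1 j) 1?eq_sym //= hornerXsubC subrr mul0r.
exact: mulr0.
Qed.

(** The sum of the weights is the coefficient of degree N - 1 of the interpolant. When it vanishes,
    multiplying by the variable only reweights; this is how linear relations between points lower
    the degree. *)
Lemma interpMX N w t :
  'X * interp N w t = interp N (fun j => t j * w j) t
     + (\sum_(j < N) w j) *: \prod_(j < N) ('X - (t j)%:P).
Proof.
rewrite /interp mulr_sumr scaler_suml -big_split; apply: eq_bigr => j _ /=.
rewrite [\prod_(l < N) _](bigD1 j) //= -!mul_polyC polyCM; ring.
Qed.

Lemma eq_interp N w w' t t' : (forall j, (j < N)%N -> w j = w' j) ->
  (forall j, (j < N)%N -> t j = t' j) -> interp N w t = interp N w' t'.
Proof.
move=> ww tt; apply: eq_bigr => j _; rewrite ww //; congr (_ *: _).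
by apply: eq_bigr => l _; rewrite tt.
Qed.

Lemma interpB N w w' t :
  interp N (fun j => w j - w' j) t = interp N w t - interp N w' t.
Proof.
by rewrite /interp -sumrB; apply: eq_bigr => j _; rewrite scalerBl.
Qed.

Lemma interpZ N a w t : interp N (fun j => a * w j) t = a *: interp N w t.
Proof.
by rewrite /interp scaler_sumr; apply: eq_bigr => j _; rewrite scalerA.
Qed.

Lemma interp_mulXsubC N w w' t a :
    (forall j, (j < N)%N -> w j * (t j - a) = w' j) -> \sum_(j < N) w j = 0 ->
  ('X - a%:P) * interp N w t = interp N w' t.
Proof.
move=> ww' w0; rewrite mulrBl interpMX w0 scale0r addr0 mul_polyC -interpZ -interpB.
by apply: eq_interp => // j jN; rewrite -ww' //; ring.
Qed.

Lemma size_mulX_leq (p : {poly F}) N :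
  (size ('X * p)%R <= N)%N -> (size p <= N.-1)%N.
Proof.
have [->|p0] := eqVneq p 0; first by rewrite size_poly0.
by rewrite mulrC size_mulX //; case: N.
Qed.

Lemma size_interp1 N w t : \sum_(j < N) w j = 0 -> (size (interp N w t) <= N.-1)%N.
Proof.
by move=> w0; apply: size_mulX_leq; rewrite interpMX w0 scale0r addr0 size_interp.
Qed.

Lemma size_interp2 N w t : \sum_(j < N) w j = 0 -> \sum_(j < N) t j * w j = 0 ->
  (size (interp N w t) <= N.-2)%N.
Proof.
move=> w0 tw0; apply: size_mulX_leq; rewrite interpMX w0 scale0r addr0.
exact: size_interp1.
Qed.

Lemma prodXsubC_indep (T : finType) (a : T -> F) (la : T -> F) l0 : injective a ->
    \sum_k la k *: \prod_(k' | k' != k) ('X - (a k')%:P)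
      + l0 *: \prod_k ('X - (a k)%:P) = 0 ->
  (forall k, la k = 0) /\ l0 = 0.
Proof.
move=> aI s0; have la0 k : la k = 0.
  have /eqP := congr1 (horner^~ (a k)) s0; rewrite horner0 hornerD hornerZ.
  rewrite [X in _ + _ * X](_ : _ = 0) ?mulr0 ?addr0; last first.
    by rewrite horner_prod (bigD1 k) //= hornerXsubC subrr mul0r.
  rewrite horner_sum [\sum_k _](bigD1 k) //= [\sum_(_ | _) _]big1 ?addr0 => [|k' kk']; last first.
    rewrite hornerZ horner_prod (bigD1 k) 1?eq_sym //= hornerXsubC subrr mul0r.
    exact: mulr0.
  rewrite hornerZ horner_prod mulf_eq0 => /orP[/eqP //|/prodf_eq0[k' kk']].
  by rewrite hornerXsubC subr_eq0 => /eqP/aI/esym/eqP; rewrite (negbTE kk').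
split=> //; move: s0; rewrite big1 ?add0r => [|k _]; last by rewrite la0 scale0r.
move/eqP; rewrite scaler_eq0 => /orP[/eqP //|/prodf_eq0[k _]].
by rewrite polyXsubC_eq0.
Qed.

(** A Cauchy matrix bordered by a constant column, with rows scaled by [tau]. Clearing denominators
    in a relation between its columns gives a polynomial of degree at most d with the d + 1 roots
    [t j]. *)
Lemma cauchy_unit d (a : 'I_d -> F) (t : 'I_d.+1 -> F) (tau : 'I_d.+1 -> F)
    (Y : 'M[F]_d.+1) :
    injective a -> injective t -> (forall j k, t j != a k) -> (forall j, tau j != 0) ->
    (forall j k, Y j (lift ord_max k) = tau j / (t j - a k)) ->
    (forall j, Y j ord_max = tau j) ->
  \det Y != 0.
Proof.
move=> aI tI ta tau0 Yk Ym; rewrite -det_tr; apply/det0P => -[v v0 vY].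
pose f := \sum_(k < d) v 0 (lift ord_max k) *: \prod_(k' | k' != k) ('X - (a k')%:P)
  + v 0 ord_max *: \prod_k ('X - (a k)%:P).
have f0 : f = 0.
  apply: (@roots_geq_poly_eq0 _ _ (codom t)); last 1 first.
  - rewrite size_codom card_ord /f (leq_trans (size_polyD _ _)) // geq_max.
    rewrite (leq_trans (size_scale_leq _ _)) ?andbT; last first.
      by rewrite size_prodXsubC_card cardT size_enum_ord.
    apply: leq_trans (size_sum _ _ _) _; apply/bigmax_leqP => k _.
    rewrite (leq_trans (size_scale_leq _ _)) // size_prodXsubC_card.
    by rewrite ltnS (leq_trans (max_card _)) // card_ord.
  - apply/allP => _ /codomP[j ->]; rewrite rootE hornerD horner_sum hornerZ.
    have /matrixP/(_ 0 j) := vY; rewrite !mxE big_ord_recr /=.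
    rewrite mxE Ym => e; set P := (\prod_k _).[_].
    have PE : P = \prod_k (t j - a k).
      by rewrite /P horner_prod; apply: eq_bigr => k _; rewrite hornerXsubC.
    rewrite -[X in X == 0](mulfK (tau0 j)) mulrDl -[v 0 _ * P * _]mulrA [P * _]mulrC mulrA.
    have -> : (\sum_(k < d) (v 0 (lift ord_max k) *: \prod_(k' | k' != k) ('X - (a k')%:P)).[t j]) * tau j
       = (\sum_(k < d) v 0 (widen_ord (leqnSn d) k) * Y^T (widen_ord (leqnSn d) k) j) * P.
      rewrite !mulr_suml; apply: eq_bigr => k _.
      have -> : widen_ord (leqnSn d) k = lift ord_max k by apply: val_inj; rewrite /= /bump leqNgt ltn_ord.
      rewrite mxE Yk PE hornerZ horner_prod [in RHS](bigD1 k) //=.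
      under eq_bigr do rewrite hornerXsubC.
      by field; rewrite subr_eq0.
    by rewrite -mulrDl e mul0r mul0r.
  - by rewrite map_inj_uniq ?enum_uniq.
have [la l0] := prodXsubC_indep aI f0.
case/eqP: v0; apply/rowP => j; rewrite mxE.
by case: (unliftP ord_max j) => [k ->|->].
Qed.

End Interpolation.

(** * Curves built from blocks *)

Lemma pull_linform_sum (K : closedFieldType) n (A : 'M[K]_n.+1) c :
  pull A (linform c) = \sum_i c i 0 *: curve_coord A i.
Proof.
rewrite /linform rmorph_sum; apply: eq_bigr => i _ /=.
by rewrite pullZ /pull mmapX mmap1U.
Qed.

Lemma feasible_of_divisors (K : closedFieldType) n (I : finType)
    (L : I -> {vspace 'rV[K]_n.+1}) (A : 'M[K]_n.+1) (h : I -> {poly K}) :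
    (0 < n)%N -> A \in unitmx ->
    (forall x, (\dim (L x) <= n)%N) -> (forall x, size (h x) = (\dim (L x)).+1) ->
    (forall x g, annih A (L x) g -> h x %| g) ->
  feasible L.
Proof.
move=> n0 uA Ln hs hd; pose C (v : 'rV[K]_n.+1) := exists s t c : K,
  [/\ (s, t) != (0, 0), c != 0 & v = c *: (veronese n s t *m A)].
exists C; first by exists A.
move=> x; apply: (@intersection_degree_of_divisor _ _ _ uA C _ _ (h x)) => //.
exact: hd.
Qed.

Section BlockConfiguration.
Variables (K : closedFieldType) (r s n : nat) (m : nat -> nat).
Hypotheses (r_gt0 : (0 < r)%N) (sum_m : \sum_(i < r) m i = n).
Notation I := ('I_r + 'I_s)%type.
Notation d := (component_dim r s m).
Notation X := (frames K n d).
(* [Some (i, k)] is the [k]-th coordinate of [Lambda_i]; [None] is the        *)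
(* equation of the hyperplane spanned by all the [Lambda_i].                  *)
Notation coord_index := (option {i : 'I_r & 'I_(m i)}).

Lemma card_coord_index : #|{: coord_index}| = n.+1.
Proof.
rewrite card_option; congr _.+1; rewrite -sum_m -sum1_card.
under [RHS]eq_bigr do rewrite -[m _]card_ord -sum1_card.
by rewrite sig_big_dep.
Qed.

Definition index_ord (c : coord_index) : 'I_n.+1 :=
  cast_ord card_coord_index (enum_rank c).
Definition ord_index (q : 'I_n.+1) : coord_index :=
  enum_val (cast_ord (esym card_coord_index) q).

Lemma index_ordK : cancel index_ord ord_index.
Proof. by move=> c; rewrite /ord_index cast_ordK enum_rankK. Qed.

Lemma ord_indexK : cancel ord_index index_ord.
Proof. by move=> q; rewrite /index_ord enum_valK cast_ordKV. Qed.

Definition frame_basis (z : 'rV[K]_n.+1) (e : X) : 'M[K]_n.+1 :=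
  \matrix_q (match ord_index q with
             | Some b => tnth (e (inl (tag b))) (tagged b)
             | None => z end).

Definition in_block (i : 'I_r) (c : coord_index) : bool :=
  if c is Some b then tag b == i else true.

(** [G i] parametrises the projected curve in P^(m i), with [G i None] as the divisor h_i.
    Multiplying it by the other h_j makes the [None] coordinates of all blocks agree, and the total
    degree is n. *)
Definition curve_coef (G : 'I_r -> coord_index -> {poly K}) (c : coord_index) :=
  if c is Some b then (\prod_(i | i != tag b) G i None) * G (tag b) c
  else \prod_i G i None.

Definition curve_mx G : 'M[K]_n.+1 := \matrix_(p, q) (curve_coef G (ord_index q))`_p.

Section Curve.
Variable G : 'I_r -> coord_index -> {poly K}.
Hypothesis sizeG : forall i c, in_block i c -> (size (G i c) <= (m i).+1)%N.

Lemma size_prodG (P : pred 'I_r) :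
  (size (\prod_(i | P i) G i None)%R <= (\sum_(i | P i) m i).+1)%N.
Proof.
apply: (big_ind2 (fun (f : {poly K}) k => (size f <= k.+1)%N)) => [|f k g l fk gl|i _].
- by rewrite size_poly1.
- exact: size_polyM_leq.
- exact: sizeG.
Qed.

Lemma size_curve_coef c : (size (curve_coef G c) <= n.+1)%N.
Proof.
case: c => [b|] /=; last by rewrite -sum_m; exact: size_prodG.
have <- : ((\sum_(i | i != tag b) m i) + m (tag b))%N = n.
  by rewrite addnC -sum_m [RHS](bigD1 (tag b)).
by apply: size_polyM_leq; [exact: size_prodG|apply: sizeG; rewrite /= eqxx].
Qed.

Lemma curve_coord_mx q : curve_coord (curve_mx G) q = curve_coef G (ord_index q).
Proof.
rewrite /curve_coord (_ : (col q _)^T = poly_rV (curve_coef G (ord_index q))).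
  by rewrite poly_rV_K // size_curve_coef.
by apply/rowP => p; rewrite !mxE.
Qed.

Lemma horner_curve_coef t (y : coord_index -> K) (k : 'I_r -> K) :
    (forall i c, in_block i c -> (G i c).[t] = k i * y c) ->
  forall c, (curve_coef G c).[t] = (\prod_i k i) * y None ^+ r.-1 * y c.
Proof.
move=> Gt; have prodE (P : pred 'I_r) :
    (\prod_(i | P i) G i None).[t] = (\prod_(i | P i) k i) * y None ^+ #|P|.
  rewrite horner_prod; under eq_bigr do rewrite Gt //.
  by rewrite big_split /= prodr_const.
case=> [b|] /=.
  rewrite hornerM prodE Gt /= ?eqxx // [in RHS](bigD1 (tag b)) //=.
  have -> : #|[pred i | i != tag b]| = r.-1 by rewrite cardC1 card_ord.
  ring.
by rewrite prodE card_ord -mulrA -exprSr prednK.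
Qed.

Lemma feasible_curve (L : I -> {vspace 'rV[K]_n.+1}) (e : X) z :
    (0 < n)%N -> (forall x, (d x <= n)%N) -> frame_of L e ->
    (forall i, size (G i None) = (m i).+1) ->
    curve_mx G \in unitmx -> frame_basis z e \in unitmx ->
    (forall j : 'I_s, exists t (y : coord_index -> K) (k : 'I_r -> K) a,
      (forall i c, in_block i c -> (G i c).[t] = k i * y c) /\
      a *: tnth (e (inr j)) ord0 = (\row_q y (ord_index q)) *m frame_basis z e) ->
  feasible L.
Proof.
move=> n0 dn Le szG uG uB /fin_all_exists[t tP].
have dL x : \dim (L x) = d x by rewrite (vector.size_basis (Le x)).
pose A := curve_mx G *m frame_basis z e.
have uA : A \in unitmx by rewrite unitmx_mul uG uB.
pose h (x : I) := match x with inl i => G i None | inr j => 'X - (t j)%:P end.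
apply: (@feasible_of_divisors _ _ _ L A h) => // [x|x|x g [sg Lg]].
- by rewrite dL.
- by rewrite dL; case: x => [i|j] /=; rewrite ?szG ?size_XsubC.
case: x Lg => [i|j] /= Lg.
  rewrite -(pull_lift uA sg) pull_linform -mulmxA -pull_linform pull_linform_sum.
  apply: (big_ind (fun p => G i None %| p)) => [|p p'|q _]; [exact: dvdp0|exact: dvdp_add|].
  rewrite -mul_polyC curve_coord_mx.
  have rowE : (frame_basis z e *m lift_poly A g) q 0 = (row q (frame_basis z e) *m lift_poly A g) 0 0.
    by rewrite -row_mul [RHS]mxE.
  rewrite rowE rowK; case: (ord_index q) => [b|] /=; last first.
    by rewrite dvdp_mull // (bigD1 i) //= dvdp_mulr.
  have [bi|bi] := eqVneq (tag b) i.
    rewrite Lg; first by rewrite mxE mul0r dvdp0.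
    by rewrite -bi (basis_mem (Le (inl (tag b)))) // mem_tnth.
  by rewrite dvdp_mull // dvdp_mulr // (bigD1 i) 1?eq_sym //= dvdp_mulr.
have [y [k [a [Gt yB]]]] := tP j.
rewrite dvdp_XsubCl rootE -(pull_lift uA sg) pullE linformE.
have -> : veronese n 1 (t j) *m A
    = ((\prod_i k i) * y None ^+ r.-1 * a) *: tnth (e (inr j)) ord0.
  rewrite -scalerA yB scalemxAl mulmxA; congr (_ *m _).
  apply/rowP => q; rewrite -curve_coordE curve_coord_mx (horner_curve_coef Gt).
  by rewrite !mxE.
rewrite -scalemxAl Lg ?scaler0 ?mxE //.
by rewrite (basis_mem (Le (inr j))) // mem_tnth.
Qed.

End Curve.

End BlockConfiguration.

Lemma big_option (R : nmodType) (T : finType) (F : option T -> R) :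
  \sum_c F c = F None + \sum_b F (Some b).
Proof.
rewrite (bigD1 None) //=; congr (_ + _).
rewrite (reindex_omap Some id) => [|[]//].
by apply: eq_bigl => b; rewrite eqxx.
Qed.

(** * Curves whose coefficients are polynomial in the frames *)

Section PolynomialFamilies.
Variables (K : closedFieldType) (n : nat) (I : finType) (d : I -> nat).
Notation X := (frames K n d).

Definition polyfam (P : X -> {poly K}) := forall k, polyfun (fun e => (P e)`_k).

Lemma eq_polyfam P Q : P =1 Q -> polyfam P -> polyfam Q.
Proof. by move=> PQ hP k; apply: eq_polyfun (hP k) => e; rewrite PQ. Qed.

Lemma polyfam_const p : polyfam (fun=> p).
Proof. by move=> k; exact: polyfunC. Qed.

Lemma polyfamC f : polyfun f -> polyfam (fun e => (f e)%:P).
Proof.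
move=> hf [|k]; first by apply: eq_polyfun hf => e; rewrite coefC.
by apply: eq_polyfun (@polyfunC K n I d 0) => e; rewrite coefC.
Qed.

Lemma polyfamB P Q : polyfam P -> polyfam Q -> polyfam (fun e => P e - Q e).
Proof.
by move=> hP hQ k; apply: eq_polyfun (polyfunB (hP k) (hQ k)) => e; rewrite coefB.
Qed.

Lemma polyfamM P Q : polyfam P -> polyfam Q -> polyfam (fun e => P e * Q e).
Proof.
move=> hP hQ k; apply: (@eq_polyfun _ _ _ _ (fun e => \sum_(j < k.+1) (P e)`_j * (Q e)`_(k - j))).
  by move=> e; rewrite coefM.
by apply: polyfun_sum => j _; apply: polyfunM.
Qed.

Lemma polyfam_sum J (r : seq J) (A : pred J) (F : J -> X -> {poly K}) :
  (forall i, A i -> polyfam (F i)) -> polyfam (fun e => \sum_(i <- r | A i) F i e).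
Proof.
move=> hF k; apply: (@eq_polyfun _ _ _ _ (fun e => \sum_(i <- r | A i) (F i e)`_k)).
  by move=> e; rewrite coef_sum.
by apply: polyfun_sum => j Aj; apply: hF.
Qed.

Lemma polyfam_prod J (r : seq J) (A : pred J) (F : J -> X -> {poly K}) :
  (forall i, A i -> polyfam (F i)) -> polyfam (fun e => \prod_(i <- r | A i) F i e).
Proof.
move=> hF; elim: r => [|i r IH].
  by apply: eq_polyfam (@polyfam_const 1) => e; rewrite big_nil.
case Ai: (A i); last by apply: eq_polyfam IH => e; rewrite big_cons Ai.
by apply: eq_polyfam (polyfamM (hF i Ai) IH) => e; rewrite big_cons Ai.
Qed.

Lemma polyfam_interp N (w t : nat -> X -> K) :
    (forall j, (j < N)%N -> polyfun (w j)) -> (forall j, (j < N)%N -> polyfun (t j)) ->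
  polyfam (fun e => interp N (w ^~ e) (t ^~ e)).
Proof.
move=> hw ht; apply: polyfam_sum => j _.
apply: (@eq_polyfam (fun e => (w j e)%:P * \prod_(l < N | l != j) ('X - (t l e)%:P))).
  by move=> e; rewrite mul_polyC.
apply: polyfamM; first exact/polyfamC/hw.
apply: polyfam_prod => l _; apply: polyfamB; first exact: polyfam_const.
exact/polyfamC/ht.
Qed.

End PolynomialFamilies.

Section GenericCurve.
Variables (K : closedFieldType) (r s n : nat) (m : nat -> nat).
Hypotheses (r_gt0 : (0 < r)%N) (sum_m : (\sum_(i < r) m i)%N = n).
Notation I := ('I_r + 'I_s)%type.
Notation d := (component_dim r s m).
Notation X := (frames K n d).
Notation coord_index := (option {i : 'I_r & 'I_(m i)}).
Notation ord_index := (ord_index sum_m).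
Notation index_ord := (index_ord sum_m).
Notation curve_mx := (curve_mx sum_m).

(** The divisors have distinct simple roots [a b], so up to a scalar the coordinates of the curve
    are the product P of all ['X - (a b)%:P] and the quotients of P by one factor, which are
    independent. *)
Lemma curve_mx_witness (G : 'I_r -> coord_index -> {poly K})
    (a : {i : 'I_r & 'I_(m i)} -> K) : injective a ->
    (forall i c, in_block i c -> (size (G i c) <= (m i).+1)%N) ->
    (forall b, ('X - (a b)%:P) * G (tag b) (Some b) = G (tag b) None) ->
    (forall i, G i None != 0) ->
  (forall i, size (G i None) = (m i).+1) /\ curve_mx G \in unitmx.
Proof.
move=> aI sG aG G0.
have rootG b : root (G (tag b) None) (a b).
  by rewrite -aG rootM root_XsubC eqxx.
split=> [i|].
  apply/eqP; rewrite eqn_leq sG //=.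
  pose ai (k : 'I_(m i)) := a (Tagged (fun i : 'I_r => 'I_(m i)) k).
  rewrite -{1}(card_ord (m i)) -(size_codom ai); apply: max_poly_roots => //.
    by apply/allP => _ /codomP[k ->]; exact: rootG (Tagged (fun i : 'I_r => 'I_(m i)) k).
  by rewrite map_inj_uniq ?enum_uniq // => k l /aI /eqP; rewrite eq_Tagged => /eqP.
pose P := curve_coef G None.
have P0 : P != 0 by apply/prodf_neq0.
have aP b : ('X - (a b)%:P) * curve_coef G (Some b) = P.
  by rewrite /P /= mulrCA aG [RHS](bigD1 (tag b)) //= mulrC.
have cB : #|{: {i : 'I_r & 'I_(m i)}}| = n.
  by apply: succn_inj; rewrite -(card_coord_index sum_m) card_option.
have ua : uniq (codom a) by rewrite map_inj_uniq ?enum_uniq.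
have aroots : all (root P) (codom a).
  by apply/allP => _ /codomP[b ->]; rewrite -(aP b) rootM root_XsubC eqxx.
have sP : size P = (size (codom a)).+1.
  apply/eqP; rewrite eqn_leq (max_poly_roots P0 aroots ua) andbT size_codom cB.
  exact: (size_curve_coef sum_m sG).
have PE : P = lead_coef P *: \prod_b ('X - (a b)%:P).
  rewrite {1}(all_roots_prod_XsubC sP aroots); last by rewrite uniq_rootsE.
  by congr (_ *: _); rewrite /codom /image_mem big_map big_enum.
have bE b : curve_coef G (Some b) = lead_coef P *: \prod_(b' | b' != b) ('X - (a b')%:P).
  have nX : 'X - (a b)%:P != 0 by rewrite polyXsubC_eq0.
  by apply: (mulfI nX); rewrite aP [LHS]PE (bigD1 b) //= scalerAr.
rewrite unitmxE unitfE -det_tr; apply/det0P => -[v v0 vG].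
have sum0 : \sum_q v 0 q *: curve_coef G (ord_index q) = 0.
  apply/polyP => k; rewrite coef_sum coef0.
  have [kn|kn] := ltnP k n.+1; last first.
    rewrite big1 // => q _; rewrite coefZ nth_default ?mulr0 //.
    exact: leq_trans (size_curve_coef sum_m sG _) kn.
  have /rowP/(_ (Ordinal kn)) := vG; rewrite !mxE => e; rewrite -[RHS]e.
  by apply: eq_bigr => q _; rewrite coefZ !mxE.
have L0 : lead_coef P != 0 by rewrite lead_coef_eq0.
have [|vb vN] := @prodXsubC_indep _ _ a (fun b => v 0 (index_ord (Some b)) * lead_coef P)
    (v 0 (index_ord None) * lead_coef P) aI.
  rewrite -[RHS]sum0 (reindex index_ord) /=; last first.
    by exists ord_index => c _; [exact: index_ordK|exact: ord_indexK].
  rewrite big_option addrC index_ordK -scalerA -PE; congr (_ + _).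
  by apply: eq_bigr => b _; rewrite index_ordK bE scalerA.
case/eqP: v0; apply/rowP => q; rewrite mxE -(ord_indexK sum_m q).
case: (ord_index q) => [b|]; apply: (mulIf L0); by rewrite mul0r.
Qed.

Lemma polyfun_frame_basis (z : 'rV[K]_n.+1) p q :
  polyfun (fun e : X => frame_basis sum_m z e p q).
Proof.
rewrite /frame_basis; case E: (ord_index p) => [b|].
  apply: (@eq_polyfun _ _ _ _ (fun e : X => tnth (e (inl (tag b))) (tagged b) 0 q)).
    by move=> e; rewrite mxE E.
  exact: polyfun_coord.
by apply: eq_polyfun (@polyfunC K n _ d (z 0 q)) => e; rewrite mxE E.
Qed.

Lemma generic_feasible (z : 'rV[K]_n.+1) (G : 'I_r -> coord_index -> X -> {poly K})
    (t : 'I_s -> X -> K) (y : 'I_s -> coord_index -> X -> K) (e0 : X)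
    (a : {i : 'I_r & 'I_(m i)} -> K) :
    (0 < n)%N -> (forall x, (d x <= n)%N) ->
    (forall i c, in_block i c -> polyfam (G i c)) ->
    (forall i c e, in_block i c -> (size (G i c e) <= (m i).+1)%N) ->
    (forall j e i, exists k, forall c, in_block i c -> (G i c e).[t j e] = k * y j c e) ->
    (forall j (e : X), exists k, k *: tnth (e (inr j)) ord0
      = (\row_q y j (ord_index q) e) *m frame_basis sum_m z e) ->
    injective a -> frame_basis sum_m z e0 = 1%:M ->
    (forall b, ('X - (a b)%:P) * G (tag b) (Some b) e0 = G (tag b) None e0) ->
    (forall i, G i None e0 != 0) ->
  for_generic d (fun L : I -> {vspace 'rV[K]_n.+1} => feasible L).
Proof.
move=> n0 dn Gpoly Gsize Gt yP aI B1 aG G0; pose Ge e i c := G i c e.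
(* The three open conditions: the curve is nondegenerate, the blocks and [z] span the space, and
   each h_i has full degree, hence no root at infinity. *)
pose phi e := \det (curve_mx (Ge e)) * \det (frame_basis sum_m z e)
  * \prod_i (G i None e)`_(m i).
have phiP : polyfun phi.
  apply: polyfunM; last first.
    by apply: polyfun_prod => i _; exact: Gpoly.
  apply: polyfunM; apply: polyfun_det => p q.
    apply: (@eq_polyfun _ _ _ _ (fun e => (curve_coef (Ge e) (ord_index q))`_p)).
      by move=> e; rewrite mxE.
    case: (ord_index q) => [b|] /=; last by apply: polyfam_prod => i _; exact: Gpoly.
    apply: polyfamM; first by apply: polyfam_prod => i _; exact: Gpoly.
    by apply: Gpoly; rewrite /= eqxx.
  exact: polyfun_frame_basis.
have phi0 : phi e0 != 0.
  have [sG uG] := curve_mx_witness aI (fun i c => Gsize i c e0) aG G0.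
  rewrite /phi B1 det1 mulr1 mulf_neq0 -?unitfE -?unitmxE //.
  by rewrite unitfE; apply/prodf_neq0 => i _; rewrite -[m i]/(m i).+1.-1 -sG -lead_coefE lead_coef_eq0.
apply: (for_generic_polyfun _ phiP phi0) => [x|L e Le]; first by rewrite ltnW ?ltnS.
rewrite !mulf_eq0 !negb_or => /andP[/andP[uG uB] /prodf_neq0 lG].
apply: (feasible_curve r_gt0 (G := Ge e) _ n0 dn Le (z := z) (sum_m := sum_m)).
- by move=> i c; exact: Gsize.
- move=> i; apply/eqP; rewrite eqn_leq Gsize //= ltnNge.
  by apply: contra (lG i isT) => sm; rewrite nth_default.
- by rewrite unitmxE unitfE.
- by rewrite unitmxE unitfE.
move=> j; have [k kE] := yP j e; have /fin_all_exists[k' k'E] := Gt j e.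
by exists (t j e), (fun c => y j c e), k', k.
Qed.

End GenericCurve.

Lemma distinct_nodes (K : closedFieldType) (T : finType) (b0 : T) M :
  exists (a : T -> K) (t : nat -> K), [/\ injective a,
    forall j j', (j < M)%N -> (j' < M)%N -> t j = t j' -> j = j',
    forall j b, (j < M)%N -> t j != a b & a b0 = 0].
Proof.
have [l [ul sl _]] := closed_field_fresh_uniq (K := K) [::] (#|T| + M).
pose u k := nth 0 l k; pose x0 := u (enum_rank b0).
have uI j j' : (j < #|T| + M)%N -> (j' < #|T| + M)%N -> (u j - x0 == u j' - x0) = (j == j').
  by move=> hj hj'; rewrite (inj_eq (addIr _)) nth_uniq // sl.
have rT (b : T) : (enum_rank b < #|T| + M)%N by exact: leq_trans (ltn_ord (enum_rank b)) (leq_addr _ _).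
exists (fun b => u (enum_rank b) - x0), (fun j => u (#|T| + j)%N - x0); split.
- move=> b b' /eqP; rewrite uI // => /eqP e.
  by apply: enum_rank_inj; exact: val_inj.
- by move=> j j' hj hj' /eqP; rewrite uI ?ltn_add2l // eqn_add2l => /eqP.
- move=> j b hj; rewrite uI ?ltn_add2l //.
  by rewrite neq_ltn ltn_addr ?orbT.
- exact: subrr.
Qed.

Lemma adj_mx1 (R : comNzRingType) k : \adj (1%:M : 'M[R]_k) = 1%:M.
Proof. by have := mul_adj_mx (1%:M : 'M[R]_k); rewrite mulmx1 det1. Qed.

(** * Linear relations between projected points *)

Section Relations.
Variables (F : fieldType) (r : nat) (m : nat -> nat).
Notation coord_index := (option {i : 'I_r & 'I_(m i)}).
Variable i : 'I_r.

(** [None] is put in the last column, the place of the constant column in [cauchy_unit]. *)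
Definition block_coord (k : 'I_(m i).+1) : coord_index :=
  if unlift ord_max k is Some k' then Some (Tagged (fun i : 'I_r => 'I_(m i)) k')
  else None.

Lemma block_coordP c : in_block i c -> exists k, c = block_coord k.
Proof.
case: c => [[i' k']|_] /=; last by exists ord_max; rewrite /block_coord unlift_none.
move=> /eqP e; subst i'.
by exists (lift ord_max k'); rewrite /block_coord liftK.
Qed.

Lemma in_block_coord k : in_block i (block_coord k).
Proof. by rewrite /block_coord; case: unlift => //= k'; exact: eqxx. Qed.

Variable y : nat -> coord_index -> F.

Definition block_rows : 'M[F]_((m i).+1) := \matrix_(j, k) y j (block_coord k).
Definition block_row j : 'rV[F]_((m i).+1) := \row_k y j (block_coord k).

(* Cramer's rule: the weights of the linear relation between the first        *)
(* [m i + 3] points in which the last two have weights proportional to [al]   *)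
(* and [be].                                                                  *)
Definition relation_weight (al be : F) (j : nat) : F :=
  if insub j is Some j' then
    (- (al *: block_row (m i).+1 + be *: block_row (m i).+2) *m \adj block_rows) 0 j'
  else (if j == (m i).+1 then al else be) * \det block_rows.

Lemma relation_weight_ord al be (j : 'I_(m i).+1) : relation_weight al be j
  = (- (al *: block_row (m i).+1 + be *: block_row (m i).+2) *m \adj block_rows) 0 j.
Proof. by rewrite /relation_weight valK. Qed.

Lemma relation_weight1 al be : relation_weight al be (m i).+1 = al * \det block_rows.
Proof. by rewrite /relation_weight insubF ?ltnn // eqxx. Qed.

Lemma relation_weight2 al be : relation_weight al be (m i).+2 = be * \det block_rows.
Proof.
by rewrite /relation_weight insubF ?ltnNge ?leqnSn // gtn_eqF.
Qed.

Lemma sum_relation_weight3 al be c : in_block i c ->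
  \sum_(j < (m i).+3) relation_weight al be j * y j c = 0.
Proof.
move=> /block_coordP[k ->]; rewrite 2!big_ord_recr /= relation_weight1 relation_weight2.
set x := al *: block_row (m i).+1 + be *: block_row (m i).+2.
have -> : \sum_(j < (m i).+1) relation_weight al be j * y j (block_coord k)
    = ((- x *m \adj block_rows) *m block_rows) 0 k.
  by rewrite mxE; apply: eq_bigr => j _; rewrite relation_weight_ord [block_rows j k]mxE.
by rewrite -mulmxA mul_adj_mx mul_mx_scalar !mxE; ring.
Qed.

Lemma sum_relation_weight2 c : in_block i c ->
  \sum_(j < (m i).+2) relation_weight 1 0 j * y j c = 0.
Proof.
move=> ic; have := sum_relation_weight3 1 0 ic.
by rewrite big_ord_recr /= relation_weight2 !mul0r addr0.
Qed.

(** The first m i + 1 points are independent, so the last two weights of a relation determine the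
    others. *)
Lemma relation_weight_unique (w : nat -> F) : \det block_rows != 0 ->
    (forall c, in_block i c -> \sum_(j < (m i).+3) w j * y j c = 0) ->
  forall j, (j < (m i).+3)%N ->
    relation_weight (w (m i).+1 / \det block_rows) (w (m i).+2 / \det block_rows) j = w j.
Proof.
move=> Y0 wy j; rewrite ltnS leq_eqVlt => /orP[/eqP ->|].
  by rewrite relation_weight2 divfK.
rewrite ltnS leq_eqVlt => /orP[/eqP ->|jm].
  by rewrite relation_weight1 divfK.
rewrite -[j]/(nat_of_ord (Ordinal jm)) relation_weight_ord.
pose v : 'rV[F]_((m i).+1) := \row_l w l.
have vY : v *m block_rows = - (w (m i).+1 *: block_row (m i).+1 + w (m i).+2 *: block_row (m i).+2).
  apply/rowP => k; have := wy _ (in_block_coord k).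
  rewrite 2!big_ord_recr /= !mxE -addrA => /eqP; rewrite addr_eq0 => /eqP <-.
  by apply: eq_bigr => l _; rewrite !mxE.
have -> : - (w (m i).+1 / \det block_rows *: block_row (m i).+1
     + w (m i).+2 / \det block_rows *: block_row (m i).+2)
    = (\det block_rows)^-1 *: (v *m block_rows).
  by rewrite vY scalerN scalerDr !scalerA ![_^-1 * _]mulrC.
rewrite -scalemxAl -mulmxA mul_mx_adj mul_mx_scalar scalerA mulVf // scale1r.
by rewrite mxE.
Qed.

(** The curve of degree m i through m i + 2 points at prescribed parameters: rescaling the points by
    a linear relation between them makes the coefficient of degree m i + 1 vanish. *)
Definition standard_block (t : nat -> F) c : {poly F} :=
  interp (m i).+2 (fun j => relation_weight 1 0 j * y j c) t.

Lemma size_standard_block t c : in_block i c -> (size (standard_block t c) <= (m i).+1)%N.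
Proof. by move=> ic; apply: size_interp1; exact: sum_relation_weight2. Qed.

Lemma horner_standard_block t j : (j < (m i).+2)%N ->
  exists k, forall c, (standard_block t c).[t j] = k * y j c.
Proof.
move=> jm; exists (relation_weight 1 0 j * \prod_(l < (m i).+2 | l != Ordinal jm) (t j - t l)).
by move=> c; rewrite -[j]/(nat_of_ord (Ordinal jm)) horner_interp mulrAC.
Qed.

Section Witness.
Variables (t : nat -> F) (a : {i : 'I_r & 'I_(m i)} -> F) (M : nat).
Hypothesis aI : injective a.
Hypothesis tI : forall j j', (j < M)%N -> (j' < M)%N -> t j = t j' -> j = j'.
Hypothesis ta : forall j b, (j < M)%N -> t j != a b.
Hypothesis y0 : forall j, (j < M)%N -> y j None != 0.
Hypothesis ya : forall j b, (j < M)%N -> y j (Some b) * (t j - a b) = y j None.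

Lemma det_block_rows_neq0 : (m i < M)%N -> \det block_rows != 0.
Proof.
move=> mM; have lM (j : 'I_(m i).+1) : (j < M)%N by exact: leq_ltn_trans (ltn_ord j : j <= m i)%N mM.
apply: (@cauchy_unit _ _ (fun k => a (Tagged (fun i : 'I_r => 'I_(m i)) k))
    (fun j => t j) (fun j => y j None)).
- by move=> k l /aI /eqP; rewrite eq_Tagged => /eqP.
- by move=> j l /tI jl; apply: val_inj; exact: jl.
- by move=> j k; exact: ta.
- by move=> j; exact: y0.
- move=> j k; rewrite mxE /block_coord liftK -(ya (Tagged _ k) (lM j)) mulfK //.
  by rewrite subr_eq0 ta.
- by move=> j; rewrite mxE /block_coord unlift_none.
Qed.

Lemma interp_witness_neq0 N (w : nat -> F) (j : 'I_N) : (N <= M)%N ->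
  w j != 0 -> interp N w t != 0.
Proof.
move=> NM wj; apply: contra_neq wj => iN.
have := horner_interp w t j; rewrite iN horner0 => /esym/eqP.
rewrite mulf_eq0 => /orP[/eqP //|/prodf_eq0[l l0]]; rewrite subr_eq0 => /eqP/tI e.
case/eqP: l0; apply: val_inj; rewrite /= -e //; exact: leq_trans (ltn_ord _) NM.
Qed.

End Witness.
End Relations.

Lemma eq_relation_weight (F : fieldType) r (m : nat -> nat) (i : 'I_r)
    (y y' : nat -> option {i : 'I_r & 'I_(m i)} -> F) al be j :
  (forall k c, y k c = y' k c) -> relation_weight i y al be j = relation_weight i y' al be j.
Proof.
move=> yy; have rowsE : block_rows i y = block_rows i y'.
  by apply/matrixP => p q; rewrite !mxE.
have rowE k : block_row i y k = block_row i y' k by apply/rowP => q; rewrite !mxE.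
by rewrite /relation_weight rowsE !rowE.
Qed.

(** * Feasible configurations *)

Section FeasibleCases.
Variables (K : closedFieldType) (r s n : nat) (m : nat -> nat).
Hypotheses (r_gt0 : (0 < r)%N) (sum_m : (\sum_(i < r) m i)%N = n).
Notation I := ('I_r + 'I_s)%type.
Notation d := (component_dim r s m).
Notation X := (frames K n d).
Notation coord_index := (option {i : 'I_r & 'I_(m i)}).
Notation ord_index := (ord_index sum_m).
Notation index_ord := (index_ord sum_m).
Hypotheses (n_gt0 : (0 < n)%N) (dn : forall x : I, (d x <= n)%N).

Section Coordinates.
Variable y0 : nat -> coord_index -> K.

Definition apex : 'rV[K]_n.+1 := delta_mx 0 (index_ord None).

Definition witness : X := fun x =>
  match x return (d x).-tuple 'rV[K]_n.+1 with
  | inl i => [tuple delta_mx 0 (index_ord (Some (Tagged (fun i : 'I_r => 'I_(m i)) k))) | k < m i]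
  | inr j => [tuple \row_q y0 j (ord_index q) | _ < 1]
  end.

(* Beyond the [s] given points, constant auxiliary points complete each       *)
(* projection to a set of points that determines the curve.                   *)
Definition point (j : nat) (e : X) : 'rV[K]_n.+1 :=
  if insub j is Some j' then tnth (e (inr j')) ord0 else \row_q y0 j (ord_index q).

(** Coordinates in the basis formed by the frames and the apex; the adjugate replaces the inverse to
    keep them polynomial, at the price of a common factor. *)
Definition point_coord (j : nat) (c : coord_index) (e : X) : K :=
  (point j e *m \adj (frame_basis sum_m apex e)) 0 (index_ord c).

Lemma point_coord_polyfun j c : polyfun (point_coord j c).
Proof.
apply: polyfun_mulmx => p q.
  rewrite /point; case: insubP => [j' _ _|_]; last exact: polyfunC.
  by apply: eq_polyfun (@polyfun_coord K n _ d (inr j') ord0 q) => e; rewrite (ord1 p).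
by apply: polyfun_adj => p' q'; exact: polyfun_frame_basis.
Qed.

Lemma frame_basis_witness : frame_basis sum_m apex witness = 1%:M.
Proof.
apply/row_matrixP => p; rewrite rowK row1 -[p in RHS](ord_indexK sum_m).
by case: (ord_index p) => [[i k]|] //=; rewrite tnth_mktuple.
Qed.

Lemma point_coord_witness j c : point_coord j c witness = y0 j c.
Proof.
rewrite /point_coord frame_basis_witness adj_mx1 mulmx1 /point.
case: insubP => [j' _ jE|_]; last by rewrite mxE index_ordK.
by rewrite /= tnth_mktuple mxE index_ordK jE.
Qed.

Lemma point_coordE (j : 'I_s) (e : X) :
  \det (frame_basis sum_m apex e) *: tnth (e (inr j)) ord0
    = (\row_q point_coord j (ord_index q) e) *m frame_basis sum_m apex e.
Proof.
rewrite (_ : \row_q _ = point j e *m \adj (frame_basis sum_m apex e)); last first.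
  by apply/rowP => q; rewrite mxE /point_coord ord_indexK.
by rewrite -mulmxA mul_adj_mx mul_mx_scalar /point valK.
Qed.

End Coordinates.

Lemma polyfun_relation_weight (i : 'I_r) (y : nat -> coord_index -> X -> K) al be j :
    (forall j c, polyfun (y j c)) ->
  polyfun (fun e => relation_weight i (fun j c => y j c e) al be j).
Proof.
move=> yP; have rowsP p q : polyfun (fun e => block_rows i (fun j c => y j c e) p q).
  by apply: eq_polyfun (yP p (block_coord q)) => e; rewrite mxE.
rewrite /relation_weight; case: insubP => [j' _ _|_].
  apply: polyfun_mulmx => p q; last exact: polyfun_adj.
  apply: (@eq_polyfun _ _ _ _ (fun e => - (al * y (m i).+1 (block_coord q) e
       + be * y (m i).+2 (block_coord q) e))).
    by move=> e; rewrite !mxE.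
  by apply/polyfunN/polyfunD; apply: polyfunM => //; exact: polyfunC.
by apply: polyfunM; [exact: polyfunC|exact: polyfun_det].
Qed.

(** The common part of the feasible cases: a special block supplies its own curve [G0], any other
    takes [standard_block]. The parameters [t] may depend on the frames, and [mult] rescales the
    points. *)
Lemma feasible_from (y0 : nat -> coord_index -> K) (a : {i : 'I_r & 'I_(m i)} -> K)
    (M : nat) (special : pred 'I_r) (G0 : 'I_r -> coord_index -> X -> {poly K})
    (y : nat -> coord_index -> X -> K) (mult t : nat -> X -> K) :
    (forall j c, polyfun (y j c)) -> (forall j, polyfun (t j)) ->
    (forall j c e, y j c e = mult j e * point_coord y0 j c e) ->
    let e0 := witness y0 in
    injective a ->
    (forall j j', (j < M)%N -> (j' < M)%N -> t j e0 = t j' e0 -> j = j') ->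
    (forall j b, (j < M)%N -> t j e0 != a b) ->
    (forall j, (j < M)%N -> y j None e0 != 0) ->
    (forall j b, (j < M)%N -> y j (Some b) e0 * (t j e0 - a b) = y j None e0) ->
    (forall i : 'I_r, (m i).+2 <= M)%N ->
    (forall i : 'I_r, ~~ special i -> (s <= (m i).+2)%N) ->
    (forall i, special i ->
      [/\ forall c, in_block i c -> polyfam (G0 i c),
          forall c e, in_block i c -> (size (G0 i c e) <= (m i).+1)%N,
          forall (j : 'I_s) e, exists k, forall c, in_block i c -> (G0 i c e).[t j e] = k * y j c e,
          forall b, tag b = i -> ('X - (a b)%:P) * G0 i (Some b) e0 = G0 i None e0
        & G0 i None e0 != 0]) ->
  for_generic d (fun L : I -> {vspace 'rV[K]_n.+1} => feasible L).
Proof.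
move=> yP tP yE e0 aI tI ta yN ya mM sm spP.
pose G i c e := if special i then G0 i c e else standard_block i (fun j c => y j c e) (t ^~ e) c.
have wP i j : polyfun (fun e => relation_weight i (fun j c => y j c e) 1 0 j).
  exact: polyfun_relation_weight.
apply: (@generic_feasible _ _ _ _ _ r_gt0 sum_m apex G (fun j => t j)
    (fun j c e => point_coord y0 j c e) e0 a) => //.
- move=> i c ic; rewrite /G; case si: (special i); first by have [h _ _ _ _] := spP i si; exact: h.
  apply: (@polyfam_interp _ _ _ _ (m i).+2
    (fun j e => relation_weight i (fun j c => y j c e) 1 0 j * y j c e) t) => // j _.
  exact: polyfunM.
- move=> i c e ic; rewrite /G; case: ifP => [si|_]; first by have [_ h _ _ _] := spP i si; exact: h.
  exact: size_standard_block.
- move=> j e i; rewrite /G; case si: (special i); last move/negbT/sm: (si) => sm'.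
    have [_ _ /(_ j e)[k kE] _ _] := spP i si.
    by exists (k * mult j e) => c ic; rewrite kE // yE mulrA.
  have [|k kE] := horner_standard_block (i := i) (fun j c => y j c e) (t ^~ e) (j := j).
    exact: leq_trans (ltn_ord j) sm'.
  by exists (k * mult j e) => c ic; rewrite kE yE mulrA.
- by move=> j e; exists (\det (frame_basis sum_m apex e)); exact: point_coordE.
- exact: frame_basis_witness.
- move=> b; rewrite /G; case: ifP => [si|_]; first by have [_ _ _ h _] := spP _ si; exact: h.
  apply: interp_mulXsubC; last by apply: sum_relation_weight2; rewrite /= eqxx.
  by move=> j jm; rewrite -mulrA ya // (leq_trans jm).
move=> i; rewrite /G; case: ifP => [si|_]; first by have [_ _ _ _ h] := spP i si.
apply: (interp_witness_neq0 tI (mM i) (j := Ordinal (ltnSn (m i).+1))).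
have := @det_block_rows_neq0 _ _ m i (fun j c => y j c e0) (t ^~ e0) a M aI tI ta yN ya (ltnW (mM i)).
by rewrite /= relation_weight1 mul1r => Y0; rewrite mulf_neq0 ?yN ?mM.
Qed.

End FeasibleCases.

(** This divided difference is the coefficient of degree N - 1 of the Lagrange interpolant of q at N
    nodes, which is q itself. *)
Lemma sum_divided_difference (F : fieldType) N (t : nat -> F) (q : {poly F}) :
    (forall j j', (j < N)%N -> (j' < N)%N -> t j = t j' -> j = j') ->
    (size q <= N.-1)%N ->
  \sum_(j < N) q.[t j] / \prod_(l < N | l != j) (t j - t l) = 0.
Proof.
case: N => [|N] tI sq; first by rewrite big_ord0.
have om0 (j : 'I_N.+1) : \prod_(l < N.+1 | l != j) (t j - t l) != 0.
  apply/prodf_neq0 => l lj; rewrite subr_eq0; apply: contraNneq lj => tl.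
  by apply/eqP/val_inj; apply: tI; rewrite ?ltn_ord.
pose w j := if insub j is Some j' then q.[t j] / \prod_(l < N.+1 | l != j') (t j - t l) else 0.
have wE (j : 'I_N.+1) : w j = q.[t j] / \prod_(l < N.+1 | l != j) (t j - t l).
  by rewrite /w valK.
have qE : interp N.+1 w t = q.
  apply/eqP; rewrite -subr_eq0; apply/eqP.
  apply: (@roots_geq_poly_eq0 _ _ (codom (fun j : 'I_N.+1 => t j))).
  - apply/allP => _ /codomP[j ->]; rewrite rootE hornerD hornerN horner_interp wE.
    by rewrite divfK ?subrr.
  - by rewrite map_inj_uniq ?enum_uniq // => j l /tI jl; apply: val_inj; apply: jl.
  rewrite size_codom card_ord (leq_trans (size_polyD _ _)) // geq_max size_interp size_polyN.
  exact: leq_trans sq (leqnSn _).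
under eq_bigr do rewrite -wE.
have := congr1 (fun p : {poly F} => p`_N.+1) (interpMX N.+1 w t).
rewrite qE mulrC coefMX /= nth_default // coefD nth_default ?size_interp // add0r coefZ.
have mP : \prod_(j < N.+1) ('X - (t j)%:P) \is monic by exact: monic_prod_XsubC.
have sP : size (\prod_(j < N.+1) ('X - (t j)%:P)) = N.+2.
  by rewrite size_prodXsubC_card card_ord.
have -> : (\prod_(j < N.+1) ('X - (t j)%:P))`_N.+1 = 1.
  by move/monicP: mP; rewrite /lead_coef sP.
by rewrite mulr1.
Qed.

Section FeasibleCases.
Variables (K : closedFieldType) (r s n : nat) (m : nat -> nat).
Hypotheses (r_gt0 : (0 < r)%N) (sum_m : (\sum_(i < r) m i)%N = n).
Notation I := ('I_r + 'I_s)%type.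
Notation d := (component_dim r s m).
Notation X := (frames K n d).
Notation index := {i : 'I_r & 'I_(m i)}.
Notation coord_index := (option index).
Hypotheses (n_gt0 : (0 < n)%N) (dn : forall x : I, (d x <= n)%N).
Hypothesis m_gt0 : forall i : 'I_r, (0 < m i)%N.

Let i0 : 'I_r := Ordinal r_gt0.
Let b0 : index := Tagged (fun i : 'I_r => 'I_(m i)) (Ordinal (m_gt0 i0)).

(** No block constrains the parameters, so they are fixed constants. *)
Lemma feasible_few_points : (forall i : 'I_r, (s <= (m i).+2)%N) ->
  for_generic d (fun L : I -> {vspace 'rV[K]_n.+1} => feasible L).
Proof.
move=> sm; have [a [t [aI tI ta _]]] := distinct_nodes K b0 n.+2.
pose y0 j (c : coord_index) : K := if c is Some b then (t j - a b)^-1 else 1.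
apply: (@feasible_from _ _ _ _ _ r_gt0 sum_m n_gt0 dn y0 a n.+2 pred0 (fun _ _ _ => 0)
  (point_coord sum_m y0) (fun _ _ => 1) (fun j _ => t j)) => //.
- by move=> j c; exact: point_coord_polyfun.
- by move=> j; exact: polyfunC.
- by move=> j c e; rewrite mul1r.
- by move=> j _; rewrite point_coord_witness oner_neq0.
- by move=> j b jM; rewrite !point_coord_witness mulVf // subr_eq0 ta.
by move=> i; rewrite !ltnS; exact: dn (inl i).
Qed.

Section FirstBlockLine.
Hypothesis m0 : m i0 = 1%N.

(* The projection to the line spanned by [Lambda_0] and the apex is the       *)
(* parametrisation itself.  Rescaling the points by [mult] makes their first  *)
(* homogeneous coordinates on this line equal, so that the second one is an   *)
(* affine parameter.                                                          *)
Lemma feasible_line_block : (forall i : 'I_r, i != i0 -> (s <= (m i).+2)%N) ->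
  for_generic d (fun L : I -> {vspace 'rV[K]_n.+1} => feasible L).
Proof.
move=> sm; pose M := (n.+2 + s)%N.
have [a [t [aI tI ta a0]]] := distinct_nodes K b0 M.
have t0 j : (j < M)%N -> t j != 0 by rewrite -a0; exact: ta.
have b0P (b : index) : tag b = i0 -> b = b0.
  case: b => [i k] /= e; subst i; apply/eqP; rewrite eq_Tagged; apply/eqP/val_inj => /=.
  have : (k < 1)%N by exact: leq_trans (ltn_ord k) (eq_leq m0).
  by case: (nat_of_ord k).
(* As [a b0 = 0], the coordinate at [b0] is 1 at the witness, where the rescaling by [mult] is
   therefore trivial and the parameter is [t j]. *)
pose y0 j (c : coord_index) : K := if c is Some b then t j / (t j - a b) else t j.
pose x1 j (e : X) := point_coord sum_m y0 j (Some b0) e.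
pose mult j (e : X) : K := \prod_(l < M | l != j :> nat) x1 l e.
pose y j c (e : X) := mult j e * point_coord sum_m y0 j c e.
pose G0 (i : 'I_r) (c : coord_index) (e : X) : {poly K} :=
  if c is Some _ then (\prod_(l < M) x1 l e)%:P else 'X.
have x1w (l : 'I_M) : x1 l (witness sum_m y0) = 1.
  by rewrite /x1 point_coord_witness /y0 a0 subr0 divff // t0.
have multw j : mult j (witness sum_m y0) = 1 by rewrite /mult big1 // => l _; exact: x1w.
have yw j c : y j c (witness sum_m y0) = y0 j c.
  by rewrite /y multw mul1r point_coord_witness.
have yP j c : polyfun (y j c).
  apply: polyfunM; last exact: point_coord_polyfun.
  by apply: polyfun_prod => l _; exact: point_coord_polyfun.
apply: (@feasible_from _ _ _ _ _ r_gt0 sum_m n_gt0 dn y0 a M (pred1 i0) G0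
  y mult (fun j e => y j None e)) => //.
- by move=> j j' jM jM'; rewrite !yw; exact: tI.
- by move=> j b jM; rewrite yw; exact: ta.
- by move=> j jM; rewrite yw; exact: t0.
- by move=> j b jM; rewrite !yw /= divfK // subr_eq0 ta.
- by move=> i; rewrite /M !addSn !ltnS; exact: leq_trans (dn (inl i)) (leq_addr _ _).
move=> _ /eqP ->; split.
- move=> [b|] _; last exact: polyfam_const.
  by apply: polyfamC; apply: polyfun_prod => l _; exact: point_coord_polyfun.
- move=> [b|] e _; rewrite m0; last by rewrite size_polyX.
  exact: leq_trans (size_polyC_leq1 _) _.
- move=> j e; exists 1 => -[b /= /eqP /b0P ->|_] /=; rewrite mul1r; last by rewrite hornerX.
  have jM : (j < M)%N by rewrite /M (leq_trans (ltn_ord j)) // leq_addl.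
  by rewrite hornerC (bigD1 (Ordinal jM)) //= mulrC.
- move=> b /b0P ->; rewrite /G0 a0 subr0 big1 ?mulr1 // => l _; exact: x1w.
by rewrite /G0 polyX_eq0.
Qed.

End FirstBlockLine.

(* Gale duality: the parameters of [m i0 + 3] points are the ratios of the    *)
(* coefficients of two linear relations between their projections.            *)
Lemma feasible_gale : (s <= (m i0).+3)%N ->
    (forall i : 'I_r, i != i0 -> (m i0 < m i)%N) ->
  for_generic d (fun L : I -> {vspace 'rV[K]_n.+1} => feasible L).
Proof.
move=> sm mm; pose M := n.+3; pose N := (m i0).+3.
have NM : (N <= M)%N by rewrite !ltnS; exact: dn (inl i0).
have [a [t [aI tI ta _]]] := distinct_nodes K b0 M.
have tIN j j' : (j < N)%N -> (j' < N)%N -> t j = t j' -> j = j'.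
  by move=> jN jN'; apply: tI; [exact: leq_trans jN NM|exact: leq_trans jN' NM].
pose y0 j (c : coord_index) : K := if c is Some b then (t j - a b)^-1 else 1.
have y0a j b : (j < M)%N -> y0 j (Some b) * (t j - a b) = y0 j None.
  by move=> jM; rewrite /= mulVf // subr_eq0 ta.
pose ai (k : 'I_(m i0)) := a (Tagged (fun i : 'I_r => 'I_(m i)) k).
pose h : {poly K} := \prod_k ('X - (ai k)%:P).
pose om j := \prod_(l < N | l != j :> nat) (t j - t l).
have om0 j : (j < N)%N -> om j != 0.
  move=> jN; apply/prodf_neq0 => l lj; rewrite subr_eq0; apply: contraNneq lj => tl.
  by apply/eqP; apply: tIN; rewrite ?ltn_ord.
have h0 j : (j < N)%N -> h.[t j] != 0.
  move=> jN; rewrite horner_prod; apply/prodf_neq0 => k _; rewrite hornerXsubC subr_eq0.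
  by apply: ta; exact: leq_trans jN NM.
(* At the witness, the coordinates in the block times [h.[t j]] are values of polynomials of degree
   at most m i0, so vanishing divided differences give relations with weights [mu0 j] and
   [t j * mu0 j]. *)
pose mu0 j := h.[t j] / om j.
have mu00 j : (j < N)%N -> mu0 j != 0.
  by move=> jN; rewrite mulf_neq0 ?invr_eq0 ?h0 ?om0.
have rel c : in_block i0 c -> exists q : {poly K}, (size q <= (m i0).+1)%N /\
    forall j, (j < N)%N -> mu0 j * y0 j c = q.[t j] / om j.
  case: c => [[i k] ik|_].
    have e : i = i0 := eqP ik.
    subst i; clear ik; exists (\prod_(k' | k' != k) ('X - (ai k')%:P)); split.
      by rewrite size_prodXsubC_card ltnS (leq_trans (max_card _)) // card_ord.
    move=> j jN; rewrite -[y0 j _]/((t j - ai k)^-1).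
    rewrite /mu0 /h (bigD1 k) //= hornerM hornerXsubC.
    have tak : t j - ai k != 0 by rewrite subr_eq0 ta // (leq_trans jN).
    by field; rewrite om0.
  exists h; split; first by rewrite size_prodXsubC_card card_ord.
  by move=> j jN; rewrite /= mulr1.
have rel1 c : in_block i0 c -> \sum_(j < N) mu0 j * y0 j c = 0.
  move=> /rel[q [sq qE]]; rewrite -[RHS](sum_divided_difference (q := q) tIN).
    by apply: eq_bigr => j _; rewrite qE.
  exact: leq_trans sq _.
have rel2 c : in_block i0 c -> \sum_(j < N) (t j * mu0 j) * y0 j c = 0.
  move=> /rel[q [sq qE]]; rewrite -[RHS](sum_divided_difference (q := 'X * q) tIN).
    by apply: eq_bigr => j _; rewrite -mulrA qE // hornerM hornerX mulrA.
  have [->|q0] := eqVneq q 0; first by rewrite mulr0 size_poly0.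
  by rewrite mulrC size_mulX.
have Y0 : \det (block_rows i0 y0) != 0.
  apply: (@det_block_rows_neq0 _ _ m i0 y0 t a M) => //.
    by move=> j _; exact: oner_neq0.
  exact: leq_trans (ltnW (ltnW (ltnSn _))) NM.
set D := \det _ in Y0; pose p := \prod_(l < N) mu0 l.
have p0 : p != 0 by apply/prodf_neq0 => l _; exact: mu00.
(* Dividing by [p] compensates for the product of the other weights in [tt] below. *)
pose mu0' j := t j * mu0 j / p.
have rel2' c : in_block i0 c -> \sum_(j < N) mu0' j * y0 j c = 0.
  move=> ic; apply: (@etrans _ _ (p^-1 * \sum_(j < N) (t j * mu0 j) * y0 j c)).
    by rewrite mulr_sumr; apply: eq_bigr => j _; rewrite /mu0' mulrAC mulrC.
  by rewrite rel2 // mulr0.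
pose W (al be : K) j (e : X) :=
  relation_weight i0 (fun j c => point_coord sum_m y0 j c e) al be j.
have WP al be j : polyfun (W al be j).
  by apply: polyfun_relation_weight => j' c; exact: point_coord_polyfun.
(* The two relations are continued to all frames by fixing their last two weights up to the
   determinant, with constants that return [mu0] and [mu0'] at the witness. *)
pose mu := W (mu0 (m i0).+1 / D) (mu0 (m i0).+2 / D).
pose mu' := W (mu0' (m i0).+1 / D) (mu0' (m i0).+2 / D).
have Ww al be j : W al be j (witness sum_m y0) = relation_weight i0 y0 al be j.
  by apply: eq_relation_weight => j' c; exact: point_coord_witness.
have muw j : (j < N)%N -> mu j (witness sum_m y0) = mu0 j.
  by move=> jN; rewrite /mu Ww; exact: relation_weight_unique Y0 rel1 j jN.
have mu'w j : (j < N)%N -> mu' j (witness sum_m y0) = mu0' j.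
  by move=> jN; rewrite /mu' Ww; exact: relation_weight_unique Y0 rel2' j jN.
pose mult j (e : X) : K := if (j < N)%N then mu j e else 1.
(* The Gale parameter [mu' j e / mu j e], multiplied by the product of all [mu l e] to be
   polynomial; the common factor only rescales the parameter. *)
pose tt j (e : X) := if (j < N)%N then mu' j e * \prod_(l < N | l != j :> nat) mu l e else t j.
pose y j c (e : X) := mult j e * point_coord sum_m y0 j c e.
pose G0 (i : 'I_r) (c : coord_index) (e : X) : {poly K} :=
  interp N (fun j => y j c e) (tt ^~ e).
have multw j : (j < M)%N -> mult j (witness sum_m y0) != 0.
  move=> _; rewrite /mult; case: ltnP => jN; last exact: oner_neq0.
  by rewrite muw // mu00.
have ttw j : (j < M)%N -> tt j (witness sum_m y0) = t j.
  move=> _; rewrite /tt; case: ltnP => // jN; rewrite mu'w //.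
  under eq_bigr do rewrite muw //.
  have pE : p = mu0 j * \prod_(l < N | l != j :> nat) mu0 l.
    by rewrite /p (bigD1 (Ordinal jN)).
  rewrite /mu0' pE; have := p0; rewrite pE; move: (\prod_(_ < _ | _) _) (mu0 j) => x x'.
  rewrite mulf_eq0 negb_or => /andP[x0 x'0].
  by field; rewrite x0 x'0.
have yP j c : polyfun (y j c).
  apply: polyfunM; last exact: point_coord_polyfun.
  by rewrite /mult; case: ltnP => _; [exact: WP|exact: polyfunC].
have ttP j : polyfun (tt j).
  rewrite /tt; case: ltnP => _; last exact: polyfunC.
  by apply: polyfunM; [exact: WP|apply: polyfun_prod => l _; exact: WP].
have sumy c e : in_block i0 c -> \sum_(j < N) y j c e = 0.
  move=> ic; rewrite -[RHS](sum_relation_weight3 (fun j c => point_coord sum_m y0 j c e)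
    (mu0 (m i0).+1 / D) (mu0 (m i0).+2 / D) ic).
  by apply: eq_bigr => j _; rewrite /y /mult ltn_ord.
have sumty c e : in_block i0 c -> \sum_(j < N) tt j e * y j c e = 0.
  move=> ic; apply: (@etrans _ _ ((\prod_(l < N) mu l e) *
      \sum_(j < N) mu' j e * point_coord sum_m y0 j c e)).
    rewrite mulr_sumr; apply: eq_bigr => j _.
    by rewrite /y /tt /mult ltn_ord [in RHS](bigD1 j) //=; ring.
  by rewrite sum_relation_weight3 // mulr0.
have yw j b : (j < M)%N -> y j (Some b) (witness sum_m y0) * (tt j (witness sum_m y0) - a b)
    = y j None (witness sum_m y0).
  by move=> jM; rewrite /y ttw // !point_coord_witness -mulrA y0a.
apply: (@feasible_from _ _ _ _ _ r_gt0 sum_m n_gt0 dn y0 a M (pred1 i0) G0 y mult tt) => //.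
- by move=> j j' jM jM'; rewrite !ttw //; exact: tI.
- by move=> j b jM; rewrite ttw //; exact: ta.
- by move=> j jM; rewrite /y point_coord_witness mulr1 multw.
- by move=> i; rewrite /M ltnW // !ltnS; exact: dn (inl i).
- by move=> i /mm mi; rewrite (leq_trans sm).
move=> _ /eqP ->; split.
- by move=> c ic; exact: polyfam_interp.
- by move=> c e ic; apply: size_interp2; [exact: sumy|exact: sumty].
- move=> j e; have jN : (j < N)%N by exact: leq_trans (ltn_ord j) sm.
  exists (\prod_(l < N | l != Ordinal jN) (tt j e - tt l e)) => c ic.
  by rewrite -[nat_of_ord j]/(nat_of_ord (Ordinal jN)) horner_interp mulrC.
- move=> b bi; apply: interp_mulXsubC; last by apply: sumy; rewrite /= bi eqxx.
  by move=> j jN; rewrite yw // (leq_trans jN).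
rewrite /G0 (eq_interp (w' := fun j => y j None (witness sum_m y0)) (t' := t)) //; last first.
  by move=> j jN; rewrite ttw // (leq_trans jN).
apply: (interp_witness_neq0 tI NM (j := ord0)).
by rewrite /y point_coord_witness mulr1 multw.
Qed.

End FeasibleCases.

(** * The theorem *)

Lemma for_generic_imp (K : closedFieldType) n (I : finType) (d : I -> nat)
    (Q Q' : (I -> {vspace 'rV[K]_n.+1}) -> Prop) :
  (forall L, Q L -> Q' L) -> for_generic d Q -> for_generic d Q'.
Proof.
by move=> QQ [U [oU nU UQ]]; exists U; split=> // L gL /(UQ L gL)/QQ.
Qed.

(** * Choice of the two projection centres *)

Section InfeasibleCases.
Variables (K : closedFieldType) (r s q : nat) (m : nat -> nat).
Hypothesis sum_m : (\sum_(i < r) m i)%N = q.+1.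
Notation I := ('I_r + 'I_s)%type.
Notation d := (component_dim r s m).
Hypothesis dn : forall x : I, (d x <= q.+1)%N.

(** A projection centre: it has vector dimension n - 1 when hi - lo = m i - 1. *)
Definition other_components (i : 'I_r) (lo hi : nat) : {set I} :=
  [set x : I | match x with inl i' => i' != i | inr j => (lo <= j < hi)%N end].

Lemma sum_other_components i lo hi : (lo <= hi)%N -> (hi <= s)%N ->
  (\sum_(x in other_components i lo hi) d x + m i = q.+1 + (hi - lo))%N.
Proof.
move=> lh hs; rewrite big_sumType /=.
under eq_bigl do rewrite inE.
under [X in (_ + X + _)%N]eq_bigl do rewrite inE.
rewrite -sum_m [in RHS](bigD1 i) //=.
have -> : (\sum_(j < s | lo <= j < hi) 1 = hi - lo)%N.
  rewrite -(big_ord_widen_cond _ (fun j => lo <= j)%N (fun=> 1%N)) //.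
  by apply: etrans (esym (big_geq_mkord _ _ predT (fun=> 1%N))) _; rewrite sum_nat_const_nat muln1.
by rewrite addnC addnA.
Qed.

Definition point_index (j : nat) (js : (j < s)%N) : {x : I & 'I_(d x)} :=
  Tagged (fun x : I => 'I_(d x)) (i := inr (Ordinal js)) (ord0 : 'I_1).

(** The cross ratio is that of the points 0, 1, k and k + 1; the auxiliary points of both centres
    lie between 2 and k - 1. *)
Lemma generic_infeasible_points (i i' : 'I_r) (hi lo' hi' k : nat)
    (z : {x : I & 'I_(d x)}) :
    (k.+1 < s)%N -> (hi <= k)%N -> (hi' <= k)%N -> (2 <= lo' <= hi')%N ->
    hi = (m i).+1 -> (0 < m i)%N -> (hi' - lo' = (m i').-1)%N -> (0 < m i')%N -> (2 <= k)%N ->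
    tag z \in other_components i 2 hi -> tag z \notin other_components i' lo' hi' ->
  for_generic d (fun L : I -> {vspace 'rV[K]_q.+2} => ~ feasible L).
Proof.
move=> ks hk hk' /andP[l2 lh'] hE mi hE' mi' k2 zX zX'.
have s0 : (0 < s)%N by lia.
have s1 : (1 < s)%N by lia.
have s3 : (k < s)%N by lia.
apply: (@generic_infeasible K q _ d (other_components i 2 hi) (other_components i' lo' hi')
  (point_index s0) (point_index s1) (point_index s3) (point_index ks) z) => //.
- have h2 : (2 <= hi)%N by lia.
  have := sum_other_components i h2 (leq_trans hk (ltnW s3)).
  by move: (\sum_(_ in _) _)%N => S; lia.
- have := sum_other_components i' lh' (leq_trans hk' (ltnW s3)).
  by move: (\sum_(_ in _) _)%N => S; lia.
- apply: (@map_uniq _ _ tag); rewrite /= !inE /eq_op /= /eq_op /=.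
  lia.
by move=> p; rewrite !inE => /or4P[] /eqP -> /=; lia.
Qed.

End InfeasibleCases.

Local Close Scope ring_scope.

(* The dimensions n_1 <= ... <= n_r are m 0 <= ... <= m r.-1. *)
Theorem theorem4p8 (R : realType) (r s n : nat) (m : nat -> nat)
    (hr : (2 <= r)%N)
    (m_gt0 : forall i, (i < r)%N -> (0 < m i)%N)
    (m_mono : forall i j, (i <= j)%N -> (j < r)%N -> (m i <= m j)%N)
    (hn : n = (\sum_(0 <= i < r) m i)%N) :
  for_generic (K := R[i]) (n := n) (component_dim r s m)
    (fun L => feasible L <->
      ((1 < m 0 /\ m 0 < m 1 /\ s <= m 0 + 3)%N \/
       ((m 0 = 1 \/ m 0 = m 1) /\ (s <= m 1 + 2)%N))).
Proof.
have r0 : (0 < r)%N by exact: ltnW.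
have sum_m : (\sum_(i < r) m i)%N = n by rewrite hn big_mkord.
have mpos (i : 'I_r) : (0 < m i)%N by exact: m_gt0.
have mn (i : 'I_r) : (m i <= n)%N by rewrite -sum_m (bigD1 i) //= leq_addr.
have n0 : (0 < n)%N by exact: leq_trans (mpos (Ordinal r0)) (mn _).
have dn (x : 'I_r + 'I_s) : (component_dim r s m x <= n)%N by case: x.
have m1 (i : 'I_r) : i != Ordinal r0 -> (m 1 <= m i)%N.
  by move=> i0; apply: m_mono => //; rewrite lt0n.
have m01 : (m 0 <= m 1)%N by exact: m_mono.
set cond := (_ \/ _).
have [yes|no] : cond \/ ~ cond.
  rewrite /cond; lia.
- apply: (@for_generic_imp _ _ _ _ (fun L => feasible L)) => [L fL|]; first by split.
  case: yes => [[m0 [m0m1 sm]]|[[m0|m0] sm]].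
  + apply: (@feasible_gale _ _ _ _ _ r0 sum_m n0 dn mpos); first by rewrite /= -addn3.
    by move=> i /m1; exact: leq_trans.
  + apply: (@feasible_line_block _ _ _ _ _ r0 sum_m n0 dn mpos m0) => i /m1 mi.
    by rewrite -addn2 (leq_trans sm) // leq_add2r.
  + apply: (@feasible_few_points _ _ _ _ _ r0 sum_m n0 dn mpos) => i.
    rewrite -addn2 (leq_trans sm) // leq_add2r -m0; exact: m_mono.
apply: (@for_generic_imp _ _ _ _ (fun L => ~ feasible L)) => [L fL|]; first by split.
case: n n0 sum_m mn dn {hn} => // q _ sum_m mn dn.
pose i0 : 'I_r := Ordinal r0; pose i1 : 'I_r := Ordinal hr.
have m0 : (0 < m 0)%N by exact: m_gt0.
have m1' : (0 < m 1)%N by exact: m_gt0.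
have [sm|sm] := leqP (m 1 + 3)%N s.
  (* The centres omit the blocks [i0] and [i1] respectively; a vector of block [i1] lies only in the
     first. *)
  apply: (@generic_infeasible_points _ _ _ _ _ sum_m dn i0 i1 (m 0).+1%N 2%N (m 1).+1%N (m 1).+1%N
    (Tagged (fun x => 'I_(component_dim r s m x)) (i := inl i1) (Ordinal (mpos i1)))) => //=; try lia.
  - by rewrite inE.
  - by rewrite inE eqxx.
have s2 : (2 < s)%N by move: no; rewrite /cond; lia.
(* Here 1 < m 0 < m 1 and s is at least m 0 + 4. Both centres omit block [i0] and use m 0 - 1
   points, starting from point 2 and point 3; as m 0 > 1, point 2 belongs to the first centre
   only. *)
apply: (@generic_infeasible_points _ _ _ _ _ sum_m dn i0 i0 (m 0).+1%N 3%N (m 0).+2%N (m 0).+2%N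
    (point_index r m s2)) => //=; try (move: no; rewrite /cond; lia).
- by rewrite inE /=; move: no; rewrite /cond; lia.
- by rewrite inE.
Qed.
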